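(* Let $\Omega\subset\mathbb{R}^2$ be a bounded domain with Lipschitz boundary, let $\nu>0$ and $\kappa>0$ be constants, let $\boldsymbol{\beta}\in W^{1,\infty}(\Omega)^2$, and let $\boldsymbol{f}\in\mathbf{Q}:=L^2(\Omega)^2$. Let $C_1,\gamma>0$ be the constants specified in the context, and set $$\widehat{C}:=\frac{(2+\sqrt2)^2}{4\nu\sqrt{C_1}\,\gamma},\qquad H:=\widehat{C}\,\|\boldsymbol{\beta}\|_{\infty,\Omega}^2+\frac{(2+\sqrt2)^2}{\kappa\frac{(2+\sqrt2)^2}{4}+2\nu\gamma^2}\,\|\boldsymbol{f}\|_{0,\Omega}.$$ Assume that the data is sufficiently small, in the sense that $1-4\widehat{C}H>0$, and assume also that $$\frac{\|\boldsymbol{\beta}\|_{\infty,\Omega}(2+\sqrt2)}{2\nu}\left(1+\frac{(2+\sqrt2)^2}{2\nu}\bigl(\min\{\nu^{-1},\kappa\}\min\{C_1,1\}\bigr)^{-1}\right)<\gamma .$$ Then there exists a unique $(\boldsymbol{\sigma},\boldsymbol{u})\in\mathbb{H}_0\times\mathbf{Q}$ such that $$a(\boldsymbol{\sigma},\boldsymbol{\tau})+b(\boldsymbol{\tau},\boldsymbol{u})+c(\boldsymbol{u},\boldsymbol{\tau})=0\quad\forall\boldsymbol{\tau}\in\mathbb{H}_0,\qquad b(\boldsymbol{\sigma},\boldsymbol{v})-d(\boldsymbol{v},\boldsymbol{u})=-\int_\Omega\boldsymbol{f}\cdot\boldsymbol{v}\quad\forall\boldsymbol{v}\in\mathbf{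Q}.$$
   Context: $\|\cdot\|_{0,\Omega}$ is the $L^2(\Omega)$ norm (for scalars, vectors, tensors) and $\|\cdot\|_{\infty,\Omega}$ the $L^\infty(\Omega)$ norm. For a tensor $\boldsymbol{\tau}\in\mathbb{R}^{2\times2}$, $\boldsymbol{\tau}^{\mathtt{d}}:=\boldsymbol{\tau}-\frac12\mathrm{tr}(\boldsymbol{\tau})\mathbb{I}$ is its deviator, '':'' is the Frobenius product, and $\mathbf{div}$ is the row-wise divergence. $\mathbb{H}=\mathbb{H}(\mathbf{div};\Omega)$ is the space of $2\times 2$ tensor fields in $L^2(\Omega)^{2\times2}$ with $\mathbf{div}\,\boldsymbol{\tau}\in L^2(\Omega)^2$, with norm $\|\boldsymbol{\tau}\|_{\mathbf{div},\Omega}^2=\|\boldsymbol{\tau}\|_{0,\Omega}^2+\|\mathbf{div}\,\boldsymbol{\tau}\|_{0,\Omega}^2$, and $\mathbb{H}_0:=\{\boldsymbol{\tau}\in\mathbb{H}:\int_\Omega\mathrm{tr}(\boldsymbol{\tau})=0\}$. Bilinear forms: $a(\boldsymbol{\rho},\boldsymbol{\tau})=\frac1\nu\int_\Omega\boldsymbol{\rho}^{\mathtt{d}}:\boldsymbol{\tau}^{\mathtt{d}}$, $b(\boldsymbol{\tau},\boldsymbol{v})=\int_\Omega\mathbf{div}\,\boldsymbol{\tau}\cdot\boldsymbol{v}$, $c(\boldsymbol{v},\boldsymbol{\tau})=\frac1\nu\int_\Omega(\boldsymbol{v}\otimes\boldsymbol{\beta})^{\mathtt{d}}:\boldsymbol{\tau}$,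 $d(\boldsymbol{v},\boldsymbol{w})=\int_\Omega\kappa\,\boldsymbol{v}\cdot\boldsymbol{w}$. Known constants (depending only on $\Omega$): $C_1>0$ is a constant such that $C_1\|\boldsymbol{\tau}\|_{0,\Omega}^2\le\|\boldsymbol{\tau}^{\mathtt{d}}\|_{0,\Omega}^2+\|\mathbf{div}\,\boldsymbol{\tau}\|_{0,\Omega}^2$ for all $\boldsymbol{\tau}\in\mathbb{H}_0$; $\gamma>0$ is an inf-sup constant, i.e. $\sup_{0\neq\boldsymbol{\tau}\in\mathbb{H}_0}\frac{b(\boldsymbol{\tau},\boldsymbol{q})}{\|\boldsymbol{\tau}\|_{\mathbf{div},\Omega}}\ge\gamma\|\boldsymbol{q}\|_{0,\Omega}$ for all $\boldsymbol{q}\in\mathbf{Q}$. *)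

(* Defs.v *)
From HB Require Import structures.
From mathcomp Require Export all_boot all_order all_algebra.
From mathcomp Require Export all_classical all_reals all_analysis.
Export Order.TTheory GRing.Theory Num.Theory.
Export numFieldNormedType.Exports.

Set Implicit Arguments.
Unset Strict Implicit.
Unset Printing Implicit Defensive.

Local Open Scope classical_set_scope.
Local Open Scope ring_scope.

(* Points of the plane are pairs, the values of vector fields are row vectors
   and the values of tensor fields are 2 x 2 matrices.  Fields are honest
   functions on the whole plane, only their restriction to the domain matters;
   elements of Lebesgue spaces are identified when they agree almost everywhere
   on the domain. *)

Notation lebesgue2 R := (@lebesgue_measure R \x @lebesgue_measure R)%E.

Section Pointwise.
Context {R : realType}.

Definition frob {m n : nat} (A B : 'M[R]_(m, n)) : R :=
  \sum_i \sum_j A i j * B i j.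

Definition enorm {m n : nat} (A : 'M[R]_(m, n)) : R := Num.sqrt (frob A A).

Definition deviator (A : 'M[R]_2) : 'M[R]_2 := A - (2^-1 * \tr A)%:M.

(* (v ⊗ w)_ij = v_i w_j *)
Definition tensor (v w : 'rV[R]_2) : 'M[R]_2 := v^T *m w.

End Pointwise.

Section Domains.
Context {R : realType}.
Implicit Type Om : set (R * R).

Definition bounded_domain Om : Prop :=
  [/\ Om !=set0, open Om, connected Om & bounded_set Om].

(* Near each boundary point, in Cartesian coordinates obtained by a rigid
   motion, Om is the strict subgraph of a Lipschitz function. *)
Definition lipschitz_boundary Om : Prop :=
  forall x0, (closure Om `\` interior Om) x0 ->
  exists (c s : R) (g : R -> R),
    [/\ c ^+ 2 + s ^+ 2 = 1,
        lipschitz g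
      & \forall x \near x0,
          Om x <-> c * (x.2 - x0.2) - s * (x.1 - x0.1)
                   < g (c * (x.1 - x0.1) + s * (x.2 - x0.2))].

End Domains.

Section LebesgueSpaces.
Context {R : realType}.
Variable Om : set (R * R).

(* Functions on Om are extended by zero to the plane. *)
Definition in_Lp (p : \bar R) {m n : nat} (F : R * R -> 'M[R]_(m, n)) : Prop :=
  forall i j, ((fun x => F x i j) \_ Om) \in Lfun (lebesgue2 R) p.

Definition Lp_norm (p : \bar R) {m n : nat} (F : R * R -> 'M[R]_(m, n)) : R :=
  fine ('N[lebesgue2 R]_p[EFin \o ((fun x => enorm (F x)) \_ Om)]).

Definition integ (f : R * R -> R) : R := \int[lebesgue2 R]_(x in Om) f x.

End LebesgueSpaces.

Section WeakDerivatives.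
Context {R : realType}.
Implicit Types (Om : set (R * R)) (phi : R * R -> R) (j : 'I_2).

Definition partial j phi : R * R -> R :=
  'D_(((j == 0)%:R, (j == 1)%:R) : R * R) phi.

Definition smooth phi : Prop :=
  forall (s : seq 'I_2) (x : R * R), differentiable (foldr partial phi s) x.

Definition test_function Om phi : Prop :=
  let supp := closure [set x | phi x != 0] in
  [/\ smooth phi, compact supp & supp `<=` Om].

Definition is_weak_partial Om j (f g : R * R -> R) : Prop :=
  forall phi, test_function Om phi ->
    integ Om (fun x => f x * partial j phi x)
    = - integ Om (fun x => g x * phi x).

Definition in_W1oo Om (b : R * R -> 'rV[R]_2) : Prop :=
  in_Lp Om +oo%E b /\
  exists2 G : R * R -> 'M[R]_2, in_Lp Om +oo%E G &
    forall i j, is_weak_partial Om j (fun x => b x 0 i) (fun x => G x i j).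

(* Row-wise distributional divergence, required to be in L^2. *)
Definition is_weak_div Om (t : R * R -> 'M[R]_2) (w : R * R -> 'rV[R]_2) :
    Prop :=
  in_Lp Om 2%:E w /\
  forall phi, test_function Om phi -> forall i,
    integ Om (fun x => \sum_j t x i j * partial j phi x)
    = - integ Om (fun x => w x 0 i * phi x).

(* Determined almost everywhere on Om, and meaningful, when t is in Hdiv. *)
Definition wdiv Om (t : R * R -> 'M[R]_2) : R * R -> 'rV[R]_2 :=
  xget (fun=> 0) [set w | is_weak_div Om t w].

Definition in_Hdiv Om (t : R * R -> 'M[R]_2) : Prop :=
  in_Lp Om 2%:E t /\ exists w, is_weak_div Om t w.

Definition in_Hdiv0 Om (t : R * R -> 'M[R]_2) : Prop :=
  in_Hdiv Om t /\ integ Om (fun x => \tr (t x)) = 0.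

Definition Hdiv_norm Om (t : R * R -> 'M[R]_2) : R :=
  Num.sqrt (Lp_norm Om 2%:E t ^+ 2 + Lp_norm Om 2%:E (wdiv Om t) ^+ 2).

End WeakDerivatives.

Section Forms.
Context {R : realType}.
Implicit Types (Om : set (R * R)) (rho tau : R * R -> 'M[R]_2)
  (v w beta : R * R -> 'rV[R]_2) (nu kappa : R).

Definition form_a Om nu rho tau : R :=
  nu^-1 * integ Om (fun x => frob (deviator (rho x)) (deviator (tau x))).

Definition form_b Om tau v : R :=
  integ Om (fun x => frob (wdiv Om tau x) (v x)).

Definition form_c Om nu beta v tau : R :=
  nu^-1 * integ Om (fun x => frob (deviator (tensor (v x) (beta x))) (tau x)).

Definition form_d Om kappa v w : R :=
  integ Om (fun x => kappa * frob (v x) (w x)).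

Definition deviator_bound Om (C1 : R) : Prop :=
  forall tau, in_Hdiv0 Om tau ->
    C1 * Lp_norm Om 2%:E tau ^+ 2
    <= Lp_norm Om 2%:E (fun x => deviator (tau x)) ^+ 2
       + Lp_norm Om 2%:E (wdiv Om tau) ^+ 2.

Definition inf_sup_b Om (gamma : R) : Prop :=
  forall q : R * R -> 'rV[R]_2, in_Lp Om 2%:E q ->
  let quotients := [set form_b Om tau q / Hdiv_norm Om tau | tau in
    [set tau | in_Hdiv0 Om tau /\ ~ (tau = cst 0 %[ae lebesgue2 R in Om])]] in
  ((gamma * Lp_norm Om 2%:E q)%:E <= ereal_sup (EFin @` quotients))%E.

Definition is_solution Om nu kappa beta (f : R * R -> 'rV[R]_2)
    (sigma : R * R -> 'M[R]_2) (u : R * R -> 'rV[R]_2) : Prop :=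
  [/\ in_Hdiv0 Om sigma, in_Lp Om 2%:E u,
      forall tau, in_Hdiv0 Om tau ->
        form_a Om nu sigma tau + form_b Om tau u + form_c Om nu beta u tau = 0
    & forall v, in_Lp Om 2%:E v ->
        form_b Om sigma v - form_d Om kappa v u
        = - integ Om (fun x => frob (f x) (v x))].

End Forms.

(* Main.v *)
From HB Require Import structures.
From mathcomp Require Import ring lra measurable_realfun ess_sup_inf.
Require Import Defs.

(* The second equation gives kappa u = div sigma + f, which leaves a variational
   problem A(sigma, tau) + K(sigma, tau) = L(tau) on H_0(div), where
   A = nu^-1 (sigma^d, tau^d) + kappa^-1 (div sigma, div tau) is an inner product
   equivalent to the H(div) one by the bound with C_1, and K is the convective
   term.  Solving A(sigma_{n+1}, .) = L - K(sigma_n, .) by the Riesz theorem is a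
   contraction for the norm of the velocity: if A(e', .) = - K(e, .) then testing
   with e' gives |e'^d| <= |beta|_oo |u|, and the inf-sup condition gives
   gamma |u'| <= 2 nu^-1 |beta|_oo |u|, where u = div e / kappa and
   u' = div e' / kappa.  Because min(nu^-1, kappa) min(C_1, 1) <= nu^-1, the second
   smallness assumption implies 4 |beta|_oo <= nu gamma; so the factor is <= 1/2.

   The divergence is only defined up to null sets, hence its linearity relies on
   the test functions exp(-c / d), d a product of distances to the sides of a
   rectangle: as c -> 0 they converge to the indicator of the rectangle, and
   rectangles generate the Borel sets of the plane. *)

Set Implicit Arguments.
Unset Strict Implicit.

Local Open Scope classical_set_scope.
Local Open Scope ring_scope.

(** * Bump functions on rectangles *)

(** The energy estimate alone would make the iteration contract with the factor |beta|_oo / sqrt(nu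
    kappa), which blows up as kappa -> 0. The convective term sees an iterate only through its
    velocity, so it is enough to contract there, where the inf-sup condition gives a factor free of
    kappa; the energy of an increment is then bounded by the velocity of the previous one, and the
    iterates converge in energy as well. Uniqueness is the same estimate with e' = e, since the
    difference of two solutions is its own successor. Fields are functions rather than classes, so
    no quotient or topology is put on them: every sequence that occurs has increments of geometric
    size, and limits are handled through bounds of the form K / 2^n. *)

Lemma is_diffP (K : realType) (U W : normedModType K) (f : U -> W)
    (L : {linear U -> W}) (x : U) : continuous L ->
  is_diff x f L <->
  forall e, 0 < e -> \forall y \near x,
    `|f y - f x - L (y - x)| <= e * `|y - x|.
Proof.
move=> Lc; split=> [[df dE] e e0|H].
  have /eqaddoP/(_ e e0) := diff_locally df.
  rewrite dE => h; rewrite (near_shift 0) /=; apply: filterS h => h'.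
  by rewrite !fctE/= !subr0 addrK opprD addrA.
have E : f \o shift x = cst (f x) + L +o_ 0 id.
  apply/eqaddoP => e e0; have := H e e0; rewrite (near_shift 0) /=.
  by apply: filterS => y; rewrite !fctE/= !subr0 addrK opprD addrA.
have dE : 'd f x = L :> (U -> W) by exact: diff_unique.
by split => //; apply/diff_locallyP; rewrite dE.
Qed.

Section Bump.
Context {R : realType}.
Implicit Types (x y v g : R * R) (f : R * R -> R).

Definition dotp g v : R := v.1 * g.1 + v.2 * g.2.

Definition has_grad f x g := is_diff x f (dotp g).

Lemma dotp_linear g : linear (dotp g : R * R -> R).
Proof.
by move=> a u v; rewrite /dotp/= !mulrDl scalerDr -!scalerAl addrACA.
Qed.

Lemma dotp_continuous g : continuous (dotp g).
Proof.
move=> v; apply: cvgD; apply: cvgM; try exact: cvg_cst.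
- exact: cvg_fst.
- exact: cvg_snd.
Qed.

(** The epsilon form is needed at points on the sides of a rectangle, where no rule of calculus
    computes the gradient of an extension by zero. *)
Lemma has_gradP f x g : has_grad f x g <->
  forall e, 0 < e -> \forall y \near x,
    `|f y - f x - dotp g (y - x)| <= e * `|y - x|.
Proof.
pose L : {linear (R * R)%type -> R} :=
  HB.pack (dotp g) (GRing.isLinear.Build _ _ _ _ _ (dotp_linear g)).
exact: (@is_diffP _ _ _ f L x (@dotp_continuous g)).
Qed.

Lemma has_grad_diff f x g : has_grad f x g -> differentiable f x.
Proof. by move=> [? _]. Qed.

Lemma has_grad_partial j f x g : has_grad f x g ->
  partial j f x = if j == 0 then g.1 else g.2.
Proof.
move=> [df dE]; rewrite /partial deriveE// dE/= /dotp.
by case: j => [[|[|//]]] /= ?; rewrite ?mul1r ?mul0r ?addr0 ?add0r.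
Qed.

Lemma has_grad_near f h x g : (\forall y \near x, f y = h y) ->
  has_grad f x g -> has_grad h x g.
Proof.
move=> fh /has_gradP H; apply/has_gradP => e e0.
by rewrite -(nbhs_singleton fh); have := H e e0; apply: filterS2 fh => y /= <-.
Qed.

Lemma has_grad_cst c x : has_grad (cst c) x 0.
Proof.
apply: (is_diff_eq (is_diff_cst _ _)).
by apply/funext => v /=; rewrite /dotp !mulr0 addr0.
Qed.

Lemma has_grad_fst x : has_grad fst x (1, 0).
Proof.
apply/has_gradP => e e0; apply: (@filterE _ (nbhs x)) => y.
by rewrite /dotp/= mulr1 mulr0 addr0 subrr normr0 mulr_ge0// ltW.
Qed.

Lemma has_grad_snd x : has_grad snd x (0, 1).
Proof.
apply/has_gradP => e e0; apply: (@filterE _ (nbhs x)) => y.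
by rewrite /dotp/= mulr1 mulr0 add0r subrr normr0 mulr_ge0// ltW.
Qed.

Lemma has_gradD f h x g k :
  has_grad f x g -> has_grad h x k -> has_grad (f + h) x (g + k).
Proof.
move=> fg hk; apply: (is_diff_eq (is_diffD fg hk)).
by apply/funext => v; rewrite /dotp !fctE/= !mulrDr addrACA.
Qed.

Lemma has_gradM f h x g k :
  has_grad f x g -> has_grad h x k -> has_grad (f * h) x (f x *: k + h x *: g).
Proof.
move=> fg hk; apply: (is_diff_eq (is_diffM fg hk)).
by apply/funext => v; rewrite /dotp !fctE/= /GRing.scale/=; ring.
Qed.

Lemma has_grad_comp f x g (p : R -> R) p' : is_derive (f x) 1 p p' ->
  has_grad f x g -> has_grad (p \o f) x (p' *: g).
Proof.
move=> [dp pE] fg.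
have dp' : is_diff (f x) p (fun h => h *: p').
  apply: DiffDef; first exact/derivable1_diffP.
  by rewrite deriv1E// derive1E pE.
apply: (is_diff_eq (is_diff_comp fg dp')).
by apply/funext => v; rewrite /dotp /= /GRing.scale/=; ring.
Qed.


Section Rectangle.
Variables a b : R * R.

Definition rect : set (R * R) :=
  [set x | [&& a.1 < x.1, x.1 < b.1, a.2 < x.2 & x.2 < b.2]].

Definition crect : set (R * R) :=
  [set x | [&& a.1 <= x.1, x.1 <= b.1, a.2 <= x.2 & x.2 <= b.2]].

(** Assembled from [fst], [snd] and constants by pointwise operations, so that its gradient follows
    from the closure rules by syntax alone. *)
Definition bdist : R * R -> R :=
  (fst + cst (- a.1)) * (cst b.1 + cst (-1) * fst)
  * ((snd + cst (- a.2)) * (cst b.2 + cst (-1) * snd)).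

Lemma bdistE x :
  bdist x = (x.1 - a.1) * (b.1 - x.1) * ((x.2 - a.2) * (b.2 - x.2)).
Proof. by rewrite /bdist !fctE !mulN1r. Qed.

Lemma bdist_gt0 x : rect x -> 0 < bdist x.
Proof. by move=> /and4P[*]; rewrite bdistE !mulr_gt0// subr_gt0. Qed.

Lemma open_rect : open rect.
Proof.
have -> : rect = (fst @^-1` `]a.1, b.1[) `&` (snd @^-1` `]a.2, b.2[).
  apply/seteqP; split => x; rewrite /rect/= !in_itv/=.
    by case/and4P=> -> -> -> ->.
  by move=> [/andP[-> ->] /andP[-> ->]].
apply: openI; apply: open_comp; try exact: interval_open.
- by move=> x _; exact: cvg_fst.
- by move=> x _; exact: cvg_snd.
Qed.

(** Polynomials in the coordinates and 1/[bdist]. If f is one of them, both partial derivatives of f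
    exp(-c/[bdist]) have the same form, so smoothness of the bumps reduces to an induction on the
    order of derivation. *)
Inductive rat_fun : (R * R -> R) -> Prop :=
| rat_cst c : rat_fun (cst c)
| rat_fst : rat_fun fst
| rat_snd : rat_fun snd
| rat_inv : rat_fun (fun x => (bdist x)^-1)
| rat_add f h : rat_fun f -> rat_fun h -> rat_fun (f + h)
| rat_mul f h : rat_fun f -> rat_fun h -> rat_fun (f * h).

Definition rat_grad f := exists q1 q2 : R * R -> R, [/\ rat_fun q1, rat_fun q2 &
  forall x, rect x -> has_grad f x (q1 x, q2 x)].

Lemma rat_grad_cst c : rat_grad (cst c).
Proof.
exists (cst 0), (cst 0); split; [exact: rat_cst..|move=> x _].
exact: has_grad_cst.
Qed.

Lemma rat_grad_fst : rat_grad fst.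
Proof.
exists (cst 1), (cst 0); split; [exact: rat_cst..|move=> x _].
exact: has_grad_fst.
Qed.

Lemma rat_grad_snd : rat_grad snd.
Proof.
exists (cst 0), (cst 1); split; [exact: rat_cst..|move=> x _].
exact: has_grad_snd.
Qed.

Lemma rat_gradD f h : rat_grad f -> rat_grad h -> rat_grad (f + h).
Proof.
move=> [f1 [f2 [rf1 rf2 F]]] [h1 [h2 [rh1 rh2 H]]].
exists (f1 + h1), (f2 + h2); split; [exact: rat_add..|move=> x rx].
exact: (has_gradD (F x rx) (H x rx)).
Qed.

Lemma rat_gradM f h : rat_fun f -> rat_fun h ->
  rat_grad f -> rat_grad h -> rat_grad (f * h).
Proof.
move=> rf rh [f1 [f2 [rf1 rf2 F]]] [h1 [h2 [rh1 rh2 H]]].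
exists (f * h1 + h * f1), (f * h2 + h * f2).
split; [by apply: rat_add; exact: rat_mul..|move=> x rx].
exact: (has_gradM (F x rx) (H x rx)).
Qed.

Lemma rat_grad_bdist : rat_grad bdist.
Proof.
do ?[exact: rat_fst|exact: rat_snd|exact: rat_cst|apply: rat_gradD|
 exact: rat_grad_cst|exact: rat_grad_fst|exact: rat_grad_snd|
  apply: rat_gradM|apply: rat_mul|apply: rat_add].
Qed.

Lemma rat_grad_inv : rat_grad (fun x => (bdist x)^-1).
Proof.
have [q1 [q2 [rq1 rq2 Q]]] := rat_grad_bdist.
pose i x := (bdist x)^-1.
exists (cst (-1) * (i * i) * q1), (cst (-1) * (i * i) * q2).
split.
- by do 2?[apply: rat_mul => //]; [exact: rat_cst|apply: rat_mul; exact: rat_inv].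
- by do 2?[apply: rat_mul => //]; [exact: rat_cst|apply: rat_mul; exact: rat_inv].
move=> x rx; have D0 := bdist_gt0 rx.
have Dn0 : id (bdist x) != 0 by rewrite gt_eqF.
have di : derivable (id : R -> R) (bdist x) 1 by exact: derivable_id.
have dV : is_derive (bdist x) 1 (fun y : R => (id y)^-1) (- (bdist x) ^- 2).
  apply: DeriveDef; first exact: derivableV.
  by rewrite deriveV// derive_id /GRing.scale/= mulr1.
have := has_grad_comp dV (Q x rx); rewrite /has_grad; congr (is_diff _ _ (dotp _)).
by rewrite /i !fctE /GRing.scale/= /scale_pair/= /GRing.scale/= expr2 invfM !mulN1r.
Qed.

Lemma rat_fun_grad f : rat_fun f -> rat_grad f.
Proof.
elim => *; [exact: rat_grad_cst|exact: rat_grad_fst|exact: rat_grad_snd|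
  exact: rat_grad_inv|exact: rat_gradD|exact: rat_gradM].
Qed.

(** Blow-up at the boundary is at most polynomial in 1/[bdist]. The base 1 + 1/[bdist] is at least
    1, so two exponents can be raised to a common one in the case of a sum. *)
Lemma rat_bound f : rat_fun f -> exists (M : R) (k : nat), [/\ 0 <= M &
  forall x, rect x -> `|f x| <= M * (1 + (bdist x)^-1) ^+ k].
Proof.
have i0 x : rect x -> 0 <= (bdist x)^-1 by move/bdist_gt0; rewrite invr_ge0; exact: ltW.
elim => [c||||{}f h _ [M [k [M0 F]]] _ [N [l [N0 H]]]
            |{}f h _ [M [k [M0 F]]] _ [N [l [N0 H]]]].
- by exists `|c|, 0; split => // x rx; rewrite expr0 mulr1.
- exists (`|a.1| + `|b.1|), 0; split => [|x /and4P[? ? ? ?]]; first exact: addr_ge0.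
  rewrite expr0 mulr1; have := normr_ge0 a.1; have := normr_ge0 b.1.
  have := ler_norm b.1; have := ler_norm (- a.1); rewrite normrN ler_norml => ? ? ? ?; apply/andP; split; lra.
- exists (`|a.2| + `|b.2|), 0; split => [|x /and4P[? ? ? ?]]; first exact: addr_ge0.
  rewrite expr0 mulr1; have := normr_ge0 a.2; have := normr_ge0 b.2.
  have := ler_norm b.2; have := ler_norm (- a.2); rewrite normrN ler_norml => ? ? ? ?; apply/andP; split; lra.
- exists 1, 1; split => // x rx; rewrite expr1 mul1r ger0_norm ?i0//.
  by rewrite lerDr.
- exists (M + N), (k + l)%N; split => [|x rx]; first exact: addr_ge0.
  rewrite !fctE; apply: (le_trans (ler_normD _ _)); rewrite mulrDl.
  have t1 : 1 <= 1 + (bdist x)^-1 by rewrite lerDl i0.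
  apply: lerD.
  + apply: (le_trans (F x rx)); apply: ler_wpM2l => //.
    by apply: ler_weXn2l => //; exact: leq_addr.
  + apply: (le_trans (H x rx)); apply: ler_wpM2l => //.
    by apply: ler_weXn2l => //; exact: leq_addl.
- exists (M * N), (k + l)%N; split => [|x rx]; first exact: mulr_ge0.
  rewrite !fctE normrM exprD mulrACA; apply: ler_pM => //; [exact: F|exact: H].
Qed.


Section Flat.
Variables (c : R) (c0 : 0 < c).

Definition rexp x := expR (- c * (bdist x)^-1).

(** Quadratic decay is what makes the differential vanish on the boundary. It comes from a single
    term of the exponential series, (c (1 + t))^(n+1) / (n+1)! <= exp(c (1 + t)) with t =
    1/[bdist]. *)
Lemma rat_rexp_bound f : rat_fun f -> exists2 C, 0 <= C &
  forall x, rect x -> `|f x * rexp x| <= C * bdist x ^+ 2.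
Proof.
move=> /rat_bound[M [k [M0 F]]].
(* The exponent n + 1 = k + 2 pays for the k powers of 1 + t in the growth of f and for the two
   powers of [bdist] in the claim; the factor exp(c) in [C0] is exp(c (1 + t)) exp(- c t). *)
pose n := k.+1.
pose C0 := expR c * (n.+1)`!%:R / c ^+ n.+1.
have C00 : 0 <= C0 by rewrite divr_ge0// ?exprn_ge0 ?mulr_ge0 ?expR_ge0// ltW.
exists (M * C0) => [|x rx]; first exact: mulr_ge0.
have D0 := bdist_gt0 rx; set t := (bdist x)^-1.
have t0 : 0 < t by rewrite invr_gt0.
have t1 : 0 < 1 + t by rewrite addr_gt0.
have E : rexp x * (1 + t) ^+ n.+1 <= C0.
  have h := expR_ge1Dxn n (ltW (mulr_gt0 c0 t1)).
  have {}h : (c * (1 + t)) ^+ n.+1 / (n.+1)`!%:R <= expR (c * (1 + t)).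
    by apply: le_trans h; rewrite lerDr.
  rewrite /C0 ler_pdivlMr ?exprn_gt0// -mulrA -exprMn [_ * c]mulrC.
  move: h; rewrite ler_pdivrMr ?ltr0n ?fact_gt0// => h.
  have rx0 : 0 <= rexp x by exact: expR_ge0.
  apply: (le_trans (ler_wpM2l rx0 h)).
  rewrite mulrA ler_pM2r ?ltr0n ?fact_gt0// -expRD ler_expR /t; lra.
rewrite normrM [`|rexp x|]ger0_norm ?expR_ge0//.
have -> : bdist x ^+ 2 = t ^- 2 by rewrite /t -exprVn invrK.
rewrite ler_pdivlMr ?exprn_gt0// -[leRHS]mulr1.
apply: (@le_trans _ _ (M * (1 + t) ^+ k * rexp x * (1 + t) ^+ 2)).
  apply: ler_pM; [by rewrite mulr_ge0// expR_ge0|exact/exprn_ge0/ltW| |].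
    by rewrite ler_wpM2r ?expR_ge0// F.
  by rewrite lerXn2r ?nnegrE ?(ltW t0) ?(ltW t1)// lerDr.
rewrite mulr1 -!mulrA ler_wpM2l//; apply: le_trans E.
by rewrite mulrCA -exprD addn2.
Qed.

Definition flat f : R * R -> R := fun x => if x \in rect then f x * rexp x else 0.

(** A point y outside lies beyond one of the four sides, so the factor of [bdist x] for that side is
    at most |x - y|; the other three are at most the size of the rectangle. *)
Lemma bdist_le_dist : exists2 K, 0 <= K &
  forall x y, rect x -> ~ rect y -> bdist x <= K * `|x - y|.
Proof.
exists (`|b - a| ^+ 3) => [|x y rx ry]; first exact: exprn_ge0.
have l1 (z : R * R) : `|z.1| <= `|z| by rewrite prod_normE le_max lexx.
have l2 (z : R * R) : `|z.2| <= `|z| by rewrite prod_normE le_max lexx orbT.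
rewrite bdistE; move: rx => /and4P[x1 x2 x3 x4].
set L := `|b - a|; set m := `|x - y|.
have L1 : b.1 - a.1 <= L by apply: le_trans (ler_norm _) (l1 (b - a)).
have L2 : b.2 - a.2 <= L by apply: le_trans (ler_norm _) (l2 (b - a)).
have m1 : `|x.1 - y.1| <= m := l1 (x - y).
have m2 : `|x.2 - y.2| <= m := l2 (x - y).
have key p q r s : 0 <= p <= L -> 0 <= q <= L -> 0 <= r <= L -> 0 <= s <= m ->
    p * q * (r * s) <= L ^+ 3 * m.
  move=> /andP[p0 pL] /andP[q0 qL] /andP[r0 rL] /andP[s0 sm].
  by rewrite mulrA !exprS expr0 mulr1 mulrA; do 3?apply: ler_pM; rewrite ?mulr_ge0.
move: m1 m2; rewrite !ler_norml => /andP[m1 m1'] /andP[m2 m2'].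
have [h|h1] := leP y.1 a.1.
  rewrite (_ : _ * _ = (b.1 - x.1) * (x.2 - a.2) * ((b.2 - x.2) * (x.1 - a.1))); last by ring.
  by apply: key; apply/andP; split; lra.
have [h|h2] := leP b.1 y.1.
  rewrite (_ : _ * _ = (x.1 - a.1) * (x.2 - a.2) * ((b.2 - x.2) * (b.1 - x.1))); last by ring.
  by apply: key; apply/andP; split; lra.
have [h|h3] := leP y.2 a.2.
  rewrite (_ : _ * _ = (b.1 - x.1) * (x.1 - a.1) * ((b.2 - x.2) * (x.2 - a.2))); last by ring.
  by apply: key; apply/andP; split; lra.
have [h|h4] := leP b.2 y.2.
  by apply: key; apply/andP; split; lra.
by exfalso; apply: ry; rewrite /rect/= h1 h2 h3 h4.
Qed.

(* The vanishing of exp(-c/bdist) at the boundary beats every power of bdist,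
   so that the extension by zero has a zero gradient outside of the rectangle. *)
Lemma flat_grad f : rat_fun f -> exists g1 g2 : R * R -> R, [/\ rat_fun g1, rat_fun g2 &
  forall x, has_grad (flat f) x (flat g1 x, flat g2 x)].
Proof.
move=> rf.
have [f1 [f2 [rf1 rf2 F]]] := rat_fun_grad rf.
have [d1 [d2 [rd1 rd2 D]]] := rat_grad_inv.
(* Product and chain rule: grad (f exp(-c/d)) = (grad f - c f grad (1/d)) exp(-c/d). *)
exists (f1 + f * (cst (- c) * d1)), (f2 + f * (cst (- c) * d2)); split.
- by apply: rat_add => //; apply: rat_mul => //; apply: rat_mul => //; exact: rat_cst.
- by apply: rat_add => //; apply: rat_mul => //; apply: rat_mul => //; exact: rat_cst.
move=> x; have [rx|nrx] := pselect (rect x).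
  have de : is_derive (- c * (bdist x)^-1) 1 expR (rexp x) by exact: is_derive_expR.
  have E := has_grad_comp de (has_gradM (has_grad_cst (- c) x) (D x rx)).
  have FE := has_gradM (F x rx) E.
  apply: (@has_grad_near (f * (expR \o (cst (- c) * (fun y => (bdist y)^-1))))).
    have : nbhs x rect by apply: open_nbhs_nbhs; split => //; exact: open_rect.
    by apply: filterS => y ry; rewrite /flat mem_set// !fctE.
  move: FE; rewrite /has_grad; congr (is_diff _ _ (dotp _)).
  rewrite /flat mem_set// !fctE/= /GRing.scale/= /scale_pair/= /GRing.scale/=.
  by rewrite !mulr0 !addr0 [LHS]surjective_pairing/=; congr pair; rewrite /rexp; ring.
rewrite /flat memNset// -[(0, 0)]/(0 : R * R) -/(flat f).
have [C C0 CP] := rat_rexp_bound rf.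
have [K K0 KP] := bdist_le_dist.
apply/has_gradP => e e0.
(* Near x the increment is at most C (K |y - x|)^2, which is below e |y - x| once |y - x| < e / (C
   K^2 + 1); the 1 keeps the denominator positive. *)
have CK : 0 < C * K ^+ 2 + 1 by rewrite ltr_wpDl// mulr_ge0// exprn_ge0.
have e1 : 0 < e / (C * K ^+ 2 + 1) by rewrite divr_gt0.
have : \forall y \near x, `|y - x| < e / (C * K ^+ 2 + 1).
  apply/nbhs_normP; exists (e / (C * K ^+ 2 + 1)) => //= y.
  by rewrite distrC.
apply: filterS => y /ltW yx.
rewrite /dotp !mulr0 addr0 subr0 {2}/flat memNset// subr0 /flat.
case: ifPn => [/set_mem ry|_]; last by rewrite normr0 mulr_ge0// ltW.
apply: (le_trans (CP y ry)).
apply: (@le_trans _ _ (C * (K * `|y - x|) ^+ 2)).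
  apply: ler_wpM2l => //; have Dy := ltW (bdist_gt0 ry).
  by rewrite lerXn2r ?nnegrE ?KP//; exact: mulr_ge0.
rewrite exprMn mulrA expr2 mulrA ler_wpM2r//.
move: yx; rewrite ler_pdivlMr// mulrC; apply: le_trans.
by rewrite ler_wpM2r// lerDl.
Qed.

Lemma smooth_flat f : rat_fun f -> smooth (flat f).
Proof.
move=> rf s x.
have [g rg ->] : exists2 g : R * R -> R, rat_fun g & foldr partial (flat f) s = flat g.
  elim: s => [|j s [g rg gE]]; first by exists f.
  have [g1 [g2 [rg1 rg2 G]]] := flat_grad rg.
  exists (if j == 0 then g1 else g2) => [|/=]; first by case: ifP.
  apply/funext => y; rewrite gE (has_grad_partial _ (G y)) /=.
  by case: ifP.
have [g1 [g2 [_ _ /(_ x) G]]] := flat_grad rg.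
exact: has_grad_diff G.
Qed.

End Flat.
End Rectangle.
End Bump.

(** * Borel sets of the plane *)

(* The measurable structure of [lebesgue2]; on [R * R] inference finds another
   instance, which is only convertible to it. *)
Local Notation plane R := (measurableTypeR R * measurableTypeR R)%type.
Local Notation pmeasurable := (@measurable _ (plane _)).

Section Plane.
Context {R : realType}.
Implicit Types (a b x : R * R) (U : set (R * R)).

Lemma rectX a b : rect a b = `]a.1, b.1[ `*` `]a.2, b.2[.
Proof.
apply/seteqP; split => x; rewrite /rect/= !in_itv/=.
  by case/and4P=> -> -> -> ->.
by move=> [/andP[-> ->] /andP[-> ->]].
Qed.

Lemma crectX a b : crect a b = `[a.1, b.1] `*` `[a.2, b.2].
Proof.
apply/seteqP; split => x; rewrite /crect/= !in_itv/=.
  by case/and4P=> -> -> -> ->.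
by move=> [/andP[-> ->] /andP[-> ->]].
Qed.

Lemma compact_crect a b : compact (crect a b).
Proof. by rewrite crectX; apply: compact_setX; exact: segment_compact. Qed.

Lemma measurable_rect a b : pmeasurable (rect a b).
Proof. by rewrite rectX; apply: measurableX. Qed.

Lemma measurable_crect a b : pmeasurable (crect a b).
Proof. by rewrite crectX; apply: measurableX. Qed.

Lemma rect_sub_crect a b : rect a b `<=` crect a b.
Proof. by move=> x /and4P[*]; rewrite /crect/= !ltW. Qed.

Lemma rectI a b a' b' : rect a b `&` rect a' b' =
  rect (Num.max a.1 a'.1, Num.max a.2 a'.2) (Num.min b.1 b'.1, Num.min b.2 b'.2).
Proof.
apply/seteqP; split => x; rewrite /rect/= !lt_min !gt_max.
  by move=> [/and4P[-> -> -> ->] /and4P[-> -> -> ->]].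
by move=> /and4P[/andP[-> ->] /andP[-> ->] /andP[-> ->] /andP[-> ->]].
Qed.

Definition ratpt (q : rat * rat) : R * R := (ratr q.1, ratr q.2).

(** Rational corners make the union countable. The closed rectangles must lie in U because they
    contain the supports of the bumps. *)
Lemma open_rect_cover U : open U ->
  U = \bigcup_(q in [set q : (rat * rat) * (rat * rat) |
                     crect (ratpt q.1) (ratpt q.2) `<=` U])
        rect (ratpt q.1) (ratpt q.2).
Proof.
move=> oU; apply/seteqP; split => [x Ux|x [q qU rx]]; last first.
  exact/qU/rect_sub_crect.
have /nbhs_ballP[e /= e0 eU] : nbhs x U by exact: open_nbhs_nbhs.
have rx (r : R) : r - e < r by rewrite gtrBl.
have rx' (r : R) : r < r + e by rewrite ltrDl.
have [p1] := rat_in_itvoo (rx x.1); rewrite in_itv/= => /andP[p1e p1x].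
have [p2] := rat_in_itvoo (rx x.2); rewrite in_itv/= => /andP[p2e p2x].
have [q1] := rat_in_itvoo (rx' x.1); rewrite in_itv/= => /andP[q1x q1e].
have [q2] := rat_in_itvoo (rx' x.2); rewrite in_itv/= => /andP[q2x q2e].
exists ((p1, p2), (q1, q2)); last by rewrite /rect/= p1x q1x p2x q2x.
move=> y /and4P[/= y1 y2 y3 y4]; apply: eU.
by split; rewrite /ball/= ltr_norml; apply/andP; split; lra.
Qed.

Lemma open_measurable2 U : open U -> pmeasurable U.
Proof.
move=> /open_rect_cover ->; rewrite bigcup_mkcond.
apply: countable_bigcupT_measurable => [|q]; first exact: countableP.
by case: ifPn => // _; exact: measurable_rect.
Qed.

Lemma continuous_measurable2 (f : R * R -> R) :
  continuous f -> measurable_fun (setT : set (plane R)) f.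
Proof.
move=> /continuousP cf.
apply: (measurability _ (RGenOpens.measurableE R)).
move=> _ [_ [a [b ->] <-]]; rewrite setTI; apply: open_measurable2.
exact/cf/interval_open.
Qed.

Definition rects : set (set (R * R)) := [set A | exists a b, A = rect a b].

(** The product sigma-algebra is generated by open strips, and a strip is the countable union of
    rectangles growing in the free direction. *)
Lemma measurable_rectsE :
  @measurable _ (plane R) = <<s rects >>.
Proof.
apply/seteqP; split; last first.
  apply: smallest_sub; first exact: sigma_algebra_measurable.
  by move=> _ [a [b ->]]; exact: measurable_rect.
apply: smallest_sub; first exact: smallest_sigma_algebra.
have Sigma := smallest_sigma_algebra setT rects.
have cup (F : (set (R * R))^nat) : (forall n, <<s rects >> (F n)) ->
  <<s rects >> (\bigcup_n F n) by have [_ _] := Sigma; apply.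
have subn (z : R) : exists n : nat, - n%:R < z < n%:R.
  exists (Num.bound `|z|); have := archi_boundP (normr_ge0 z).
  by rewrite ltr_norml.
rewrite subUset; split.
  have -> : preimage_set_system setT (@fst R R) (@measurable _ (measurableTypeR R))
      = <<s preimage_set_system setT (@fst R R) (@RGenOpens.G R) >>.
    by rewrite g_sigma_preimageE -RGenOpens.measurableE.
  apply: smallest_sub => // _ [_ [x [y ->]] <-].
  have -> : setT `&` fst @^-1` `]x, y[ = \bigcup_n rect (x, - n%:R) (y, n%:R).
    apply/seteqP; split => z /=; rewrite in_itv/=.
      move=> [_ /andP[z1 z2]]; have [n /andP[n1 n2]] := subn z.2.
      by exists n => //; rewrite /rect/= z1 z2 n1 n2.
    by move=> [n _ /and4P[/= -> ->]].
  by apply: cup => n; apply: sub_gen_smallest; exists (x, - n%:R), (y, n%:R).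
have -> : preimage_set_system setT (@snd R R) (@measurable _ (measurableTypeR R))
    = <<s preimage_set_system setT (@snd R R) (@RGenOpens.G R) >>.
  by rewrite g_sigma_preimageE -RGenOpens.measurableE.
apply: smallest_sub => // _ [_ [x [y ->]] <-].
have -> : setT `&` snd @^-1` `]x, y[ = \bigcup_n rect (- n%:R, x) (n%:R, y).
  apply/seteqP; split => z /=; rewrite in_itv/=.
    move=> [_ /andP[z1 z2]]; have [n /andP[n1 n2]] := subn z.1.
    by exists n => //; rewrite /rect/= z1 z2 n1 n2.
  by move=> [n _ /and4P[/= _ _ -> ->]].
by apply: cup => n; apply: sub_gen_smallest; exists (- n%:R, x), (n%:R, y).
Qed.

Lemma setI_closed_rects : setI_closed rects.
Proof. by move=> _ _ [a [b ->]] [a' [b' ->]]; rewrite rectI; eexists; eexists. Qed.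

Local Notation mu := (lebesgue2 R).

Lemma crect_lty a b : (mu (crect a b) < +oo)%E.
Proof.
rewrite crectX product_measure1E//= !lebesgue_measure_itv/=.
by case: ifP; case: ifP => _ _; rewrite ?mule0 ?mul0e// -EFinM ltry.
Qed.

Lemma bounded_sub_crect U : bounded_set U -> exists a b, U `<=` crect a b.
Proof.
move=> [M [_ MU]].
have {}MU := MU (M + 1) ltac:(by rewrite ltrDl).
exists (- (M + 1), - (M + 1)), (M + 1, M + 1) => x /MU /=.
rewrite prod_normE ge_max /= !ler_norml => /andP[/andP[? ?] /andP[? ?]].
by rewrite /crect/=; apply/and4P; split.
Qed.

Lemma bounded_lty U : pmeasurable U -> bounded_set U -> (mu U < +oo)%E.
Proof.
move=> mU /bounded_sub_crect[a [b Uab]]; apply: (le_lt_trans _ (crect_lty a b)).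
by apply: le_measure; rewrite ?inE//; exact: measurable_crect.
Qed.

Lemma continuous_bounded U (f : R * R -> R) : bounded_set U -> continuous f ->
  exists M, forall x, U x -> `|f x| <= M.
Proof.
move=> /bounded_sub_crect[a [b Uab]] cf.
have : compact (f @` crect a b).
  by apply: continuous_compact (@compact_crect a b); exact: continuous_subspaceT.
move=> /compact_bounded[M [_ MP]]; exists (M + 1) => x Ux.
by apply: (MP (M + 1)); [rewrite ltrDl|exists x => //; exact: Uab].
Qed.

End Plane.

(** * The fundamental lemma of the calculus of variations *)

Section GenericNull.
Context d (T : measurableType d) (R : realType) (mu : {measure set T -> \bar R}).
Implicit Types (D Q : set T) (w : T -> R).

(** Dominated convergence with majorant |w|; it carries the vanishing from bumps to the indicator of
    a rectangle. *)
Lemma integral0_cvg D w (phi : nat -> T -> R) (psi : T -> R) :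
  measurable D -> mu.-integrable D (EFin \o w) ->
  (forall n, measurable_fun D (phi n)) -> (forall n x, `|phi n x| <= 1) ->
  (forall x, phi n x @[n --> \oo] --> psi x) ->
  (forall n, \int[mu]_(x in D) (w x * phi n x) = 0) ->
  (\int[mu]_(x in D) (w x * psi x)%:E = 0)%E.
Proof.
move=> mD iw mphi phi1 phicvg w0.
pose F n x := (w x * phi n x)%:E.
have mw : measurable_fun D w by apply/measurable_EFinP; exact: measurable_int iw.
have mF n : measurable_fun D (F n).
  by apply/measurable_EFinP; exact: measurable_funM.
have Fle n x : (`|F n x| <= `|(EFin \o w) x|)%E.
  by rewrite lee_fin normrM ler_piMr.
(* The real integral is [fine] of the extended one, so its vanishing alone would allow an infinite
   value; integrability excludes this. *)
have FE n : (\int[mu]_(x in D) F n x = 0)%E.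
  have iF : mu.-integrable D (F n) by apply: le_integrable iw.
  have := w0 n; rewrite /Rintegral => H.
  by rewrite -[LHS]fineK ?H//; exact: integrable_fin_num.
have Fcvg x : D x -> F n x @[n --> \oo] --> (w x * psi x)%:E.
  move=> _; apply: cvg_EFin; first exact: nearW.
  by apply: cvgM; [exact: cvg_cst|exact: phicvg].
have ia := integrable_abse iw.
have H : (\int[mu]_(x in D) F n x)%E @[n --> \oo] -->
    (\int[mu]_(x in D) (w x * psi x)%:E)%E.
  exact: (dominated_cvg mD mF Fcvg _ ia).
rewrite -(cvg_lim _ H)//; apply: lim_near_cst => //.
exact: nearW.
Qed.

Lemma negligible_bigcup_countable (I : countType) (F : I -> set T) :
  (forall i, mu.-negligible (F i)) -> mu.-negligible (\bigcup_i F i).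
Proof.
move=> F0.
have : mu.-negligible (\bigcup_n if unpickle n is Some i then F i else set0).
  apply: negligible_bigcup => n; case: (unpickle n) => [i|] /=.
    exact: F0.
  exact: negligible_set0.
by apply: negligibleS => x [i _ Fx]; exists (pickle i) => //; rewrite pickleK.
Qed.

(** Dynkin's argument: the sets A over which w has zero integral on Q form a lambda-system, which
    contains the whole space by the assumption on Q itself. Hence all measurable sets qualify, and w
    vanishes almost everywhere. *)
Lemma ae_eq0_generated (G : set (set T)) Q w :
  @measurable _ T = <<s G >> -> setI_closed G ->
  measurable Q -> mu.-integrable Q (EFin \o w) ->
  (\int[mu]_(x in Q) (w x)%:E = 0)%E ->
  (forall A, G A -> (\int[mu]_(x in Q `&` A) (w x)%:E = 0)%E) ->
  {ae mu, forall x, Q x -> w x = 0}.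
Proof.
move=> GE GI mQ iw w0 wG.
have mw : measurable_fun Q (EFin \o w) by exact: measurable_int iw.
have all0 A : measurable A -> (\int[mu]_(x in Q `&` A) (w x)%:E = 0)%E.
  move=> mA; have : <<s G >> A by rewrite -GE.
  pose P A := (\int[mu]_(x in Q `&` A) (w x)%:E = 0)%E.
  apply: (@dynkin_induction _ _ G P GE GI) => {A mA}//; rewrite /P.
  - by rewrite setIT.
  - move=> S mS PS.
    have := w0; rewrite -{1}(setIT Q) -(setUv S) setIUr integral_setU.
    + by rewrite PS add0e.
    + exact: measurableI.
    + by apply: measurableI => //; exact: measurableC.
    + by rewrite -setIUr setUv setIT.
    + by apply/disj_setPS => x [[_ ?] [_ ?]].
  - move=> F mF tF F0; rewrite setI_bigcupr integral_bigcup//.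
    + by apply: eseries0 => i _ _; exact: F0.
    + exact: trivIset_setIl.
    + by move=> k; exact: measurableI.
    + rewrite -setI_bigcupr; apply: integrableS iw => //.
      by apply: measurableI => //; exact: bigcupT_measurable.
have : ae_eq mu Q (EFin \o w) (cst 0%E).
  apply: integral_ae_eq => // E EQ mE.
  by rewrite integral0 -(setIidr EQ); exact: all0.
by apply: filterS => x /= + Qx => /(_ Qx) [].
Qed.

End GenericNull.

Section TestFunctions.
Context {R : realType}.
Implicit Types (a b x : R * R) (Om : set (R * R)).
Local Notation mu := (lebesgue2 R).

Lemma test_flat Om a b c : 0 < c -> crect a b `<=` Om ->
  test_function Om (flat a b c (cst 1)).
Proof.
move=> c0 abOm.
have sub : closure [set x | flat a b c (cst 1) x != 0] `<=` crect a b.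
  have cl : closed (crect a b).
    by apply: compact_closed; [exact: norm_hausdorff|exact: compact_crect].
  apply: (subset_trans _ cl); apply: closure_subset => x /=.
  rewrite /flat; case: ifPn => [/set_mem rx _|_]; last by rewrite eqxx.
  exact: rect_sub_crect.
split.
- by apply: smooth_flat => //; exact: rat_cst.
- apply: (subclosed_compact _ (@compact_crect R a b) sub).
  exact: closed_closure.
- exact: subset_trans abOm.
Qed.

Lemma flat_ge0_le1 a b c x : 0 < c -> 0 <= flat a b c (cst 1) x <= 1.
Proof.
move=> c0; rewrite /flat; case: ifPn => [/set_mem rx|_]; last by rewrite lexx ler01.
rewrite mul1r expR_ge0/= /rexp -expR0 ler_expR mulNr oppr_le0.
by rewrite mulr_ge0 ?invr_ge0 ?(ltW (bdist_gt0 rx))// ltW.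
Qed.

Lemma flat_cvg a b x :
  (fun n => flat a b (harmonic n) (cst 1) x) @ \oo --> (\1_(rect a b) x : R).
Proof.
rewrite /flat indicE; case: (boolP (x \in rect a b)) => rx; last exact: cvg_cst.
rewrite /=.
have h : (fun n => - harmonic n * (bdist a b x)^-1) @ \oo -->
    (- 0 * (bdist a b x)^-1 : R).
  by apply: cvgM; [apply: cvgN; exact: cvg_harmonic|exact: cvg_cst].
have := cvgM (cvg_cst (1 : R)) (cvg_comp _ _ h (@continuous_expR R _)).
by rewrite oppr0 mul0r expR0 mulr1; apply.
Qed.

Lemma flat_continuous a b c : 0 < c -> continuous (flat a b c (cst 1)).
Proof.
move=> c0 x; apply: differentiable_continuous.
exact: (smooth_flat (a := a) (b := b) c0 (rat_cst _ _ 1) nil x).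
Qed.

Lemma rect_integral0 Om a b (w : R * R -> R) : pmeasurable Om ->
  mu.-integrable Om (EFin \o w) ->
  (forall phi, test_function Om phi -> integ Om (fun x => w x * phi x) = 0) ->
  crect a b `<=` Om -> (\int[mu]_(x in rect a b) (w x)%:E = 0)%E.
Proof.
move=> mOm iw w0 abOm.
have h0 n : 0 < harmonic n :> R by exact: harmonic_gt0.
have -> : rect a b = Om `&` rect a b.
  by rewrite setIidr//; exact: subset_trans (@rect_sub_crect _ a b) abOm.
rewrite integral_mkcondr.
have -> : ((fun x => (w x)%:E) \_ (rect a b)) = (fun x => (w x * \1_(rect a b) x)%:E).
  by apply/funext => x; rewrite patchE indicE; case: ifP; rewrite ?mulr1 ?mulr0.
apply: (@integral0_cvg _ (plane R) R mu Om w
  (fun n => flat a b (harmonic n) (cst 1))) => //.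
- move=> n; apply: measurable_funTS; apply: continuous_measurable2.
  exact: flat_continuous.
- by move=> n x; have /andP[? ?] := flat_ge0_le1 a b x (h0 n); rewrite ger0_norm.
- exact: flat_cvg.
- by move=> n; apply: w0; exact: test_flat.
Qed.

(** On each rectangle whose closure lies in Om the bumps and Dynkin's argument give w = 0 almost
    everywhere, and countably many such rectangles cover Om. *)
Lemma test_function_ae0 Om (w : R * R -> R) : open Om ->
  mu.-integrable Om (EFin \o w) ->
  (forall phi, test_function Om phi -> integ Om (fun x => w x * phi x) = 0) ->
  {ae mu, forall x, Om x -> w x = 0}.
Proof.
move=> oOm iw w0.
have mOm : pmeasurable Om by exact: open_measurable2.
have loc a b : crect a b `<=` Om -> {ae mu, forall x, rect a b x -> w x = 0}.
  move=> abOm.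
  have rOm := subset_trans (@rect_sub_crect _ a b) abOm.
  apply: (@ae_eq0_generated _ (plane R) R mu (@rects R)).
  - exact: measurable_rectsE.
  - exact: setI_closed_rects.
  - exact: measurable_rect.
  - by apply: integrableS iw => //; exact: measurable_rect.
  - exact: rect_integral0 mOm iw w0 abOm.
  - move=> _ [a' [b' ->]]; rewrite rectI; apply: rect_integral0 mOm iw w0 _.
    apply: subset_trans abOm => x; rewrite /crect/= !le_min !ge_max.
    by move=> /and4P[/andP[-> _] /andP[-> _] /andP[-> _] /andP[-> _]].
(* Putting the inclusion inside the implication makes [N q] empty for rectangles that leave Om, so
   the union can run over all rational corners. *)
pose N q := ~` [set x : R * R | crect (ratpt q.1) (ratpt q.2) `<=` Om ->
  rect (ratpt q.1) (ratpt q.2) x -> w x = 0].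
have Nn : mu.-negligible (\bigcup_q N q).
  apply: negligible_bigcup_countable => q.
  have [/loc|H] := pselect (crect (ratpt q.1) (ratpt q.2) `<=` Om).
    by apply: negligibleS => x; rewrite /N/=; apply: contra_not => + _ => /[apply].
  rewrite (_ : N q = set0); first exact: negligible_set0.
  by rewrite -subset0 => x; rewrite /N/=; apply.
apply: negligibleS Nn => x /= /not_implyP[Omx wx].
have : (\bigcup_(q in [set q : (rat * rat) * (rat * rat) |
    crect (ratpt q.1) (ratpt q.2) `<=` Om])
    rect (ratpt q.1) (ratpt q.2)) x by rewrite -open_rect_cover.
move=> [q qOm rx]; exists q => //= h.
by apply: wx; apply: h.
Qed.

End TestFunctions.

(** * Complete semi-inner products *)

Section Quadratic.
Context {R : realType}.

(** The discriminant inequality. The case a = 0 has to be covered because a seminorm can vanish on a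
    nonzero vector. *)
Lemma quad_ge0_le (a b c : R) : 0 <= a ->
  (forall t, 0 <= a * t ^+ 2 + 2 * b * t + c) -> b ^+ 2 <= a * c.
Proof.
rewrite le_eqVlt => /predU1P[<-|a0] H.
  rewrite mul0r; have [->|b0] := eqVneq b 0; first by rewrite expr0n.
  (* At this t the affine function 2 b t + c equals -1. *)
  have := H (- (c + 1) / (2 * b)).
  rewrite mul0r add0r mulrC divfK ?mulf_neq0// => h; lra.
have := H (- b / a).
have -> : a * (- b / a) ^+ 2 + 2 * b * (- b / a) + c = (a * c - b ^+ 2) / a.
  by field; rewrite gt_eqF.
by rewrite ler_pdivlMr// mul0r subr_ge0.
Qed.

Lemma le0_geometric (x K : R) : (forall n, x <= K / 2 ^+ n) -> x <= 0.
Proof.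
move=> H; rewrite leNgt; apply/negP => x0.
have h : K / 2 ^+ n @[n --> \oo] --> 0.
  under eq_fun do rewrite -exprVn.
  rewrite -(mulr0 K); apply: cvgM; first exact: cvg_cst.
  by apply: cvg_expr; rewrite ger0_norm ?invf_lt1// ltr1n.
have : x <= lim (K / 2 ^+ n @[n --> \oo]).
  by apply: limr_ge; [exact: cvgP h|exact: nearW].
by rewrite (cvg_lim _ h)// leNgt x0.
Qed.

Lemma sqrrD_le (x y : R) : (x + y) ^+ 2 <= 2 * (x ^+ 2 + y ^+ 2).
Proof.
by have := sqr_ge0 (x - y); rewrite sqrrB sqrrD => h; lra.
Qed.

Lemma le_of_sqr (x c : R) : 0 <= x -> 0 <= c -> x ^+ 2 <= c * x -> x <= c.
Proof.
rewrite le_eqVlt => /predU1P[<-//|x0] _.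
by rewrite expr2 ler_pM2r.
Qed.

End Quadratic.

Section SemiHilbert.
Context {R : realType} {V : lmodType R}.
Variables (D : set V) (A : V -> V -> R).

(* Positive semidefinite forms need not be definite, so that functions do not
   have to be identified when they agree almost everywhere. *)
Definition semi_inner := [/\
  D 0, forall (a : R) u v, D u -> D v -> D (a *: u + v),
  forall u v, D u -> D v -> A u v = A v u,
  forall (a : R) u v w, D u -> D v -> D w -> A (a *: u + v) w = a * A u w + A v w
  & forall u, D u -> 0 <= A u u].

(** [A u u] is a squared seminorm, so the increments have size at most sqrt(C) / 2^n and are
    summable. Completeness is only asked for such sequences, with an explicit rate for the limit, so
    that no topology on V is involved. *)
Definition fast_complete := forall (u : nat -> V) (C : R),
  (forall n, D (u n)) ->
  (forall n, A (u n.+1 - u n) (u n.+1 - u n) <= C / 4 ^+ n) ->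
  exists (l : V) (K : R), D l /\ forall n, A (u n - l) (u n - l) <= K / 2 ^+ n.

Hypothesis inner : semi_inner.

Let D0 : D 0. Proof. by case: inner. Qed.

Let DZD (a : R) u v : D u -> D v -> D (a *: u + v).
Proof. by case: inner => _ + _ _ _; apply. Qed.

Let Asym u v : D u -> D v -> A u v = A v u.
Proof. by case: inner => _ _ + _ _; apply. Qed.

Let AZD (a : R) u v w : D u -> D v -> D w ->
  A (a *: u + v) w = a * A u w + A v w.
Proof. by case: inner => _ _ _ + _; apply. Qed.

Let A_ge0 u : D u -> 0 <= A u u.
Proof. by case: inner => _ _ _ _; apply. Qed.

Let DB u v : D u -> D v -> D (u - v).
Proof. by move=> Du Dv; rewrite addrC -scaleN1r; exact: DZD. Qed.

Let AB u v w : D u -> D v -> D w -> A (u - v) w = A u w - A v w.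
Proof. by move=> *; rewrite addrC -scaleN1r AZD// mulN1r addrC. Qed.

Let AZDr (a : R) u v w : D u -> D v -> D w ->
  A w (a *: u + v) = a * A w u + A w v.
Proof. by move=> Du Dv Dw; rewrite Asym ?AZD ?(Asym _ Dw)//; exact: DZD. Qed.

Let A_quad (a : R) u v : D u -> D v ->
  A (a *: u + v) (a *: u + v) = A u u * a ^+ 2 + 2 * A v u * a + A v v.
Proof.
move=> Du Dv; rewrite AZD ?AZDr//; last exact: DZD.
by rewrite (Asym Du Dv); ring.
Qed.

Lemma semi_inner_CS u v : D u -> D v -> A u v ^+ 2 <= A u u * A v v.
Proof.
move=> Du Dv; rewrite Asym//; apply: quad_ge0_le => [|t]; first exact: A_ge0.
by rewrite -A_quad//; exact/A_ge0/DZD.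
Qed.

Hypothesis complete : fast_complete.

Definition linear_on (L : V -> R) :=
  forall (a : R) u v, D u -> D v -> L (a *: u + v) = a * L u + L v.

(** The representative minimizes J(v) = A(v, v) - 2 L(v), which is bounded below by -M.
    Near-minimizers almost solve the Euler equation, and this also makes a minimizing sequence
    Cauchy. *)
Lemma semi_riesz (L : V -> R) (M : R) : 0 <= M -> linear_on L ->
  (forall v, D v -> L v ^+ 2 <= M * A v v) ->
  exists2 s, D s & forall v, D v -> A s v = L v.
Proof.
move=> M0 Llin LM.
pose J v := A v v - 2 * L v.
have J_ge v : D v -> - M <= J v.
  move=> Dv; rewrite /J lerBrDl -lerBrDr opprK; set a := A v v.
  have a0 : 0 <= a by exact: A_ge0.
  have := LM v Dv; rewrite -/a => h.
  have aM : 0 <= a + M by exact: addr_ge0.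
  apply: le_trans (ler_norm _) _; rewrite -(ger0_norm aM) -ler_sqr ?nnegrE//.
  rewrite real_normK ?num_real// real_normK ?num_real//.
  have := sqr_ge0 (a - M); rewrite sqrrB sqrrD exprMn => h2; lra.
have Jquad (t : R) v w : D v -> D w ->
    J (t *: w + v) = A w w * t ^+ 2 + 2 * (A v w - L w) * t + J v.
  by move=> Dv Dw; rewrite /J A_quad// Llin//; ring.
have hinf : has_inf [set J v | v in D].
  by split; [exists (J 0), 0|exists (- M) => _ [v Dv <-]; exact: J_ge].
set m := inf [set J v | v in D].
have m_le v : D v -> m <= J v by move=> Dv; apply: ge_inf; [case: hinf|exists v].
(* The accuracy 4^-n is chosen to match [fast_complete]. *)
have /choice[u uP] : forall n : nat, exists v, D v /\ J v <= m + (4 ^+ n)^-1.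
  move=> n; have d0 : 0 < (4 ^+ n)^-1 :> R by rewrite invr_gt0 exprn_gt0.
  by have [_ [v Dv <-] /ltW Jv] := inf_adherent d0 hinf; exists v.
have uD n : D (u n) := (uP n).1.
have uJ n : J (u n) <= m + (4 ^+ n)^-1 := (uP n).2.
(* J(u_n + t w) - m is a nonnegative quadratic polynomial in t with constant term at most 4^-n; its
   discriminant bounds the residual. *)
have resid n w : D w -> (A (u n) w - L w) ^+ 2 <= A w w * (4 ^+ n)^-1.
  move=> Dw; apply: quad_ge0_le => [|t]; first exact: A_ge0.
  have := m_le _ (DZD t Dw (uD n)); rewrite Jquad// => h.
  by have := uJ n; lra.
have cauchy n : A (u n.+1 - u n) (u n.+1 - u n) <= 4 / 4 ^+ n.
  set e := u n.+1 - u n; have De : D e by exact: DB.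
  apply: le_of_sqr; [exact: A_ge0|by rewrite divr_ge0 ?exprn_ge0|].
  (* The increment e tested with itself is the difference of two residuals in the direction e,
     whence A(e, e)^2 <= 4 A(e, e) / 4^n. *)
  have E : A e e = (A (u n.+1) e - L e) + - (A (u n) e - L e).
    by rewrite {1}/e AB//; ring.
  have h0 : A e e ^+ 2 <= 2 * ((A (u n.+1) e - L e) ^+ 2 + (A (u n) e - L e) ^+ 2).
    by rewrite E -(sqrrN (A (u n) e - _)) sqrrD_le.
  have h1 := resid n e De; have h2 := resid n.+1 e De.
  have e0 := A_ge0 De.
  have h3 : A e e * (4 ^+ n.+1)^-1 <= A e e * (4 ^+ n)^-1.
    apply: ler_wpM2l => //; rewrite lef_pV2 ?posrE ?exprn_gt0//.
    by rewrite ler_weXn2l// ler1n.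
  rewrite (_ : 4 / 4 ^+ n * A e e = 4 * (A e e * (4 ^+ n)^-1)); first by lra.
  by rewrite -mulrA [_^-1 * _]mulrC.
have [l [K [Dl lK]]] := complete uD cauchy.
exists l => // w Dw; apply/eqP; rewrite -subr_eq0 -sqrf_eq0 eq_le sqr_ge0 andbT.
have w0 := A_ge0 Dw.
apply: (@le0_geometric _ _ (2 * A w w * (1 + K))) => n.
have -> : A l w - L w = (A (u n) w - L w) + - A (u n - l) w.
  by rewrite AB//; ring.
apply: (le_trans (sqrrD_le _ _)); rewrite sqrrN.
have h1 := resid n w Dw.
have h2 : A (u n - l) w ^+ 2 <= A w w * (K / 2 ^+ n).
  apply: (le_trans (semi_inner_CS (DB (uD n) Dl) Dw)).
  by rewrite mulrC; apply: ler_wpM2l.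
have h3 : A w w * (4 ^+ n)^-1 <= A w w * (2 ^+ n)^-1.
  apply: ler_wpM2l => //; rewrite lef_pV2 ?posrE ?exprn_gt0//.
  by rewrite lerXn2r ?nnegrE// ler_nat.
rewrite (_ : 2 * _ * _ / _ = 2 * (A w w * (2 ^+ n)^-1 + A w w * (K / 2 ^+ n))).
  by lra.
by ring.
Qed.

(* Picard iteration for [A s t + K s t = L t]; the contraction takes place in
   the coarser quadratic seminorm [N]. *)
Lemma semi_picard (K : V -> V -> R) (N L : V -> R) (M ML c : R) :
  0 <= M -> 0 <= ML ->
  linear_on L -> (forall v, D v -> L v ^+ 2 <= ML * A v v) ->
  (forall u, D u -> linear_on (K u)) ->
  (forall v, D v -> linear_on (K ^~ v)) ->
  (forall u, D u -> 0 <= N u <= c * A u u) ->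
  (forall u v, D u -> D v -> K u v ^+ 2 <= M * N u * A v v) ->
  (forall e e', D e -> D e' -> (forall v, D v -> A e' v = - K e v) ->
     N e' <= N e / 4) ->
  exists2 s, D s & forall v, D v -> A s v + K s v = L v.
Proof.
move=> M0 ML0 Llin LM Klin1 Klin2 Nc KM key.
have N_ge0 u : D u -> 0 <= N u by move=> /Nc/andP[].
have N_le u : D u -> N u <= c * A u u by move=> /Nc/andP[].
have stepE u : exists s, D u -> D s /\ forall v, D v -> A s v = L v - K u v.
  (* [choice] needs a total relation; 0 is a dummy value outside D. *)
  have [Du|nDu] := pselect (D u); last by exists 0.
  have [s Ds sP] : exists2 s, D s & forall v, D v -> A s v = L v - K u v.
    apply: (@semi_riesz (fun v => L v - K u v) (2 * (ML + M * N u))).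
    - by rewrite mulr_ge0// addr_ge0// mulr_ge0// N_ge0.
    - by move=> a v w Dv Dw; rewrite Llin// Klin1//; ring.
    - move=> v Dv; apply: (le_trans (sqrrD_le _ _)); rewrite sqrrN.
      by have := LM v Dv; have := KM u v Du Dv; lra.
  by exists s.
have [step stepP] := choice stepE.
pose s n := iter n step 0.
have sD n : D (s n) by elim: n => [|n IH]//=; have [] := stepP _ IH.
have sE n v : D v -> A (s n.+1) v = L v - K (s n) v.
  by move=> Dv; have [_] := stepP _ (sD n); apply.
pose e n := s n.+1 - s n.
have eD n : D (e n) by exact: DB.
have KB u v w : D u -> D v -> D w -> K (u - v) w = K u w - K v w.
  move=> Du Dv Dw; rewrite addrC -scaleN1r (Klin2 w Dw (-1) v u Dv Du) mulN1r.
  exact: addrC.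
have eE n v : D v -> A (e n.+1) v = - K (e n) v.
  by move=> Dv; rewrite /e AB// !sE// KB//; ring.
have Ne n : N (e n) <= N (e 0) / 4 ^+ n.
  elim: n => [|n IH]; first by rewrite expr0 divr1.
  apply: (le_trans (key _ _ (eD n) (eD n.+1) (eE n))).
  rewrite exprSr invfM mulrA ler_pM2r ?invr_gt0//.
(* Testing the equation of the increment with itself bounds its energy by [N] of the previous
   increment; the contraction factor 1/4 yields the rate that [fast_complete] expects. *)
have Ae n : A (e n.+1) (e n.+1) <= M * N (e 0) / 4 ^+ n.
  have MN : M * N (e n) <= M * N (e 0) / 4 ^+ n.
    by rewrite -mulrA; apply: ler_wpM2l.
  apply: le_trans MN; apply: le_of_sqr.
  - exact/A_ge0/eD.
  - by rewrite mulr_ge0// N_ge0.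
  - by rewrite {1}eE// sqrrN KM.
(* The sequence starts at [s 1] because [Ae] says nothing about the first increment. Below, [s n.+2]
   approximates l in A and [s n.+1] in K, as in the equation of a step. *)
have [l [C [Dl lC]]] := complete (fun n => sD n.+1) Ae.
exists l => // v Dv; apply/eqP; rewrite -subr_eq0 -sqrf_eq0 eq_le sqr_ge0 andbT.
have v0 := A_ge0 Dv.
have c0 : 0 <= `|c| by [].
apply: (@le0_geometric _ _ (4 * A v v * C * (1 + M * `|c|))) => n.
have -> : A l v + K l v - L v = - A (s n.+2 - l) v + - K (s n.+1 - l) v.
  by rewrite AB// KB// sE//; ring.
apply: (le_trans (sqrrD_le _ _)); rewrite !sqrrN.
have C0 k : 0 <= C / 2 ^+ k by apply: le_trans (lC k); exact/A_ge0/DB.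
have h1 : A (s n.+2 - l) v ^+ 2 <= A v v * (C / 2 ^+ n).
  apply: (le_trans (semi_inner_CS (DB (sD n.+2) Dl) Dv)).
  rewrite mulrC; apply: ler_wpM2l => //; apply: (le_trans (lC n.+1)).
  rewrite exprSr invfM mulrA ler_piMr//; lra.
have h2 : K (s n.+1 - l) v ^+ 2 <= A v v * (C / 2 ^+ n) * (M * `|c|).
  have De : D (s n.+1 - l) by exact: DB.
  apply: (le_trans (KM _ _ De Dv)).
  rewrite (_ : _ * (M * _) = M * (`|c| * (C / 2 ^+ n)) * A v v); last by ring.
  apply: ler_wpM2r => //; apply: ler_wpM2l => //.
  apply: (le_trans (N_le _ De)).
  apply: (@le_trans _ _ (`|c| * A (s n.+1 - l) (s n.+1 - l))).
    by apply: ler_wpM2r; [exact: A_ge0|exact: ler_norm].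
  by apply: ler_wpM2l => //; exact: lC.
have h3 : 0 <= A v v * (C / 2 ^+ n) by rewrite mulr_ge0.
have h4 : 0 <= A v v * (C / 2 ^+ n) * (M * `|c|).
  by apply: mulr_ge0 => //; exact: mulr_ge0.
rewrite (_ : 4 * _ * _ * _ / _ =
  4 * (A v v * (C / 2 ^+ n) + A v v * (C / 2 ^+ n) * (M * `|c|))).
  by lra.
by ring.
Qed.

End SemiHilbert.

(** * Completeness of L^2 *)

Lemma fast_cauchy_cvg (R : realType) (a : nat -> R) (K : R) :
  (forall n j, (a (n + j)%N - a n) ^+ 2 <= K / 2 ^+ n) ->
  cvgn a /\ forall n, (lim (a @ \oo) - a n) ^+ 2 <= K / 2 ^+ n.
Proof.
move=> aK.
have K0 : 0 <= K by have := aK 0%N 0%N; rewrite subrr expr0n/= expr0 divr1.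
have ca : cvgn a.
  apply/cauchy_cvgP/cauchy_exP => e e0.
  have [n Kn] : exists n, K / 2 ^+ n < e ^+ 2.
    apply: contrapT => /forallNP H.
    have : e ^+ 2 <= 0 by apply: (@le0_geometric _ _ K) => n; rewrite leNgt; exact/negP.
    by rewrite leNgt exprn_gt0.
  exists (a n); exists n => // m /= nm; rewrite -(subnKC nm) -ball_normE/= distrC.
  rewrite -(@ltr_pXn2r _ 2)// ?nnegrE ?(ltW e0)// real_normK ?num_real//.
  exact: le_lt_trans Kn.
split => // n.
have h : (a m - a n) ^+ 2 @[m --> \oo] --> (lim (a @ \oo) - a n) ^+ 2.
  rewrite expr2; under eq_fun do rewrite expr2.
  by apply: cvgM; apply: cvgB => //; exact: cvg_cst.
rewrite -(cvg_lim _ h)//; apply: limr_le; first exact: cvgP h.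
by exists n => // m /= nm; rewrite -(subnKC nm).
Qed.

Section L2.
Context d (T : measurableType d) (R : realType) (mu : {measure set T -> \bar R}).
Variables (D : set T) (mD : measurable D).
Implicit Types f g : T -> R.

Definition L2 f := (f \_ D) \in Lfun mu 2%:E.

Lemma L2P f : L2 f <->
  measurable_fun D f /\ mu.-integrable D (EFin \o (fun x => f x ^+ 2)).
Proof.
have sqE : (EFin \o (fun x => (f \_ D) x ^+ 2)) =
    (EFin \o (fun x => f x ^+ 2)) \_ D.
  apply/funext => x; rewrite /= !patchE; case: ifP => //.
  by rewrite expr0n.
split=> [Lf|[mf fi]].
  split.
    apply/measurable_restrictT => //.
    by have := sub_Lfun_mfun Lf; rewrite inE.
  by apply/integrable_mkcond => //; rewrite -sqE; exact: Lfun2_integrable_sqr.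
rewrite /L2 inE; apply/andP; split; rewrite inE/=.
  exact/(measurable_restrictT _ mD).
rewrite /finite_norm unlock; apply: poweR_lty.
move/(integrable_mkcond _ mD) : fi; rewrite -sqE => /integrableP[_].
apply: le_lt_trans; apply: ge0_le_integral => //.
- by move=> x _; exact: poweR_ge0.
- apply: (measurableT_comp (measurable_poweR _)) => //.
  apply: measurableT_comp => //; apply/measurable_EFinP.
  exact/(measurable_restrictT _ mD).
- apply: measurableT_comp => //; apply/measurable_EFinP.
  by apply: measurable_funX; exact/(measurable_restrictT _ mD).
- by move=> x _ /=; rewrite lee_fin powR_mulrn// normrX.
Qed.

Lemma L2_measurable f : L2 f -> measurable_fun D f.
Proof. by move=> /L2P[]. Qed.

Lemma L2_sqr f : L2 f -> mu.-integrable D (EFin \o (fun x => f x ^+ 2)).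
Proof. by move=> /L2P[]. Qed.

Lemma L2M f g : L2 f -> L2 g -> mu.-integrable D (EFin \o (fun x => f x * g x)).
Proof.
move=> Lf Lg; have mf := L2_measurable Lf; have mg := L2_measurable Lg.
apply: (le_integrable mD _ _ (integrableD mD (L2_sqr Lf) (L2_sqr Lg))).
  by apply/measurable_EFinP; exact: measurable_funM.
move=> x Dx /=; rewrite lee_fin [leRHS]ger0_norm ?addr_ge0 ?sqr_ge0//.
rewrite ler_norml; have := sqr_ge0 (f x - g x); have := sqr_ge0 (f x + g x).
have := sqr_ge0 (f x); have := sqr_ge0 (g x).
by rewrite sqrrB sqrrD => h1 h2 h3 h4; apply/andP; split; lra.
Qed.

Lemma L2ZD (a : R) f g : L2 f -> L2 g -> L2 (fun x => a * f x + g x).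
Proof.
move=> Lf Lg; have mf := L2_measurable Lf; have mg := L2_measurable Lg.
have m : measurable_fun D (fun x => a * f x + g x).
  by apply: measurable_funD => //; exact: measurable_funM.
apply/L2P; split => //.
pose h (x : T) : \bar R := ((2 * a ^+ 2)%R%:E * (EFin \o (fun x => f x ^+ 2)%R) x +
  2%:E * (EFin \o (fun x => g x ^+ 2)%R) x)%E.
have hi : mu.-integrable D h.
  by apply: integrableD => //; apply: integrableZl => //; exact: L2_sqr.
apply: (le_integrable mD _ _ hi).
  by apply/measurable_EFinP; exact: measurable_funX.
move=> x Dx; rewrite /h /= lee_fin ger0_norm ?sqr_ge0//.
apply: le_trans (ler_norm _); apply: (le_trans (sqrrD_le _ _)).
by rewrite exprMn; lra.
Qed.

Lemma L2_0 : L2 (cst 0).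
Proof.
apply/L2P; split; first exact: measurable_cst.
have -> : (EFin \o (fun x : T => cst 0 x ^+ 2)) = cst 0%E :> (T -> \bar R).
  by apply/funext => x /=; rewrite expr0n.
exact: integrable0.
Qed.

Lemma L2Z (a : R) f : L2 f -> L2 (fun x => a * f x).
Proof.
move=> Lf; have := L2ZD a Lf L2_0.
by under eq_fun do rewrite addr0.
Qed.

Lemma L2B f g : L2 f -> L2 g -> L2 (fun x => f x - g x).
Proof.
move=> Lf Lg; have := L2ZD (-1) Lg Lf.
by under eq_fun do rewrite mulN1r addrC.
Qed.

Lemma L2D f g : L2 f -> L2 g -> L2 (fun x => f x + g x).
Proof.
move=> Lf Lg; have := L2ZD 1 Lf Lg.
by under eq_fun do rewrite mul1r.
Qed.

Lemma L2_bounded f (M : R) : (mu D < +oo)%E -> measurable_fun D f ->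
  (forall x, D x -> `|f x| <= M) -> L2 f.
Proof.
move=> Dfin mf fM; apply/L2P; split => //.
apply: measurable_bounded_integrable => //; first exact: measurable_funX.
exists (M ^+ 2); split; first exact: num_real.
move=> y My x /= Dx; rewrite normrX (le_trans _ (ltW My))//.
by rewrite lerXn2r ?nnegrE ?fM// (le_trans _ (fM _ Dx)).
Qed.

(* With [S = sum_n 2^n (u (n+1) - u n)^2], which is integrable, the tails satisfy
   [(u m - u n)^2 <= 2^(1-n) S] pointwise, and this bound passes to the limit. *)
Lemma L2_complete (u : nat -> T -> R) (C : R) : (forall n, L2 (u n)) ->
  (forall n, \int[mu]_(x in D) (u n.+1 x - u n x) ^+ 2 <= C / 4 ^+ n) ->
  exists (l : T -> R) (K : R), L2 l /\
    forall n, \int[mu]_(x in D) (u n x - l x) ^+ 2 <= K / 2 ^+ n.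
Proof.
move=> uL uC.
pose dd n x := (2 ^+ n * (u n.+1 x - u n x) ^+ 2)%:E.
have dd0 n x : (0 <= dd n x)%E by rewrite lee_fin mulr_ge0// sqr_ge0.
have mdd n : measurable_fun D (dd n).
  apply/measurable_EFinP; apply: measurable_funM => //.
  by apply: measurable_funX; apply: measurable_funB; exact: L2_measurable.
(* The weight 2^n against the bound C / 4^n leaves the summable C / 2^n, with total 2 C. *)
have idd n : (\int[mu]_(x in D) dd n x <= (C / 2 ^+ n)%:E)%E.
  have iu : mu.-integrable D (EFin \o (fun x => (u n.+1 x - u n x) ^+ 2)).
    by apply: L2_sqr; exact: L2B.
  rewrite /dd; under eq_integral do rewrite EFinM.
  rewrite integralZl// -[X in (_ * X)%E]fineK; last exact: integrable_fin_num.
  rewrite -EFinM lee_fin; apply: le_trans (_ : 2 ^+ n * (C / 4 ^+ n) <= _).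
    by apply: ler_wpM2l => //; exact: uC.
  rewrite (_ : 4 = 2 * 2 :> R) ?exprMn ?invfM; last by ring.
  by rewrite mulrCA mulVKf ?expf_neq0.
pose S x := (\sum_(n <oo) dd n x)%E.
have mS : measurable_fun D S by exact: ge0_emeasurable_sum.
have S0 x : (0 <= S x)%E by exact: nneseries_ge0.
have iS : (\int[mu]_(x in D) S x <= (2 * C)%:E)%E.
  rewrite integral_nneseries//.
  have := @cvg_geometric_eseries_half R (2 * C) 0.
  rewrite expr0 divr1 => /cvg_lim <- //.
  apply: lee_nneseries => [i _ _|i _]; first exact: integral_ge0.
  apply: (le_trans (idd i)); rewrite lee_fin addn1 natrX exprS invfM mulrACA.
  by rewrite divff// mul1r.
have tail n j x : (((u (n + j)%N x - u n x) ^+ 2 * 2 ^+ n)%:E <= 2%:E * S x)%E.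
  have step : 2 ^+ n * (u (n + j)%N x - u n x) ^+ 2 <=
      2 * \sum_(n <= i < n + j) 2 ^+ i * (u i.+1 x - u i x) ^+ 2.
    (* The factor 2 lost in (p + q)^2 <= 2 p^2 + 2 q^2 is recovered from the weight, which passes
       from 2^n to 2^(n+1); the constant therefore does not grow with j. *)
    elim: j n => [|j IH] n.
      by rewrite addn0 subrr expr0n/= mulr0 big_geq// mulr0.
    rewrite big_ltn ?addnS ?ltnS ?leq_addr// -addSn mulrDr.
    have := IH n.+1; set s := \sum_(_ <= _ < _) _; rewrite exprS.
    set v := u (n.+1 + j)%N x; set y := u n.+1 x; set z := u n x.
    have -> : v - z = (y - z) + (v - y) by ring.
    have := sqrrD_le (y - z) (v - y).
    set p := (_ + _) ^+ 2; set q := (y - z) ^+ 2; set r := (v - y) ^+ 2 => h1 h2.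
    have h3 : 2 ^+ n * p <= 2 ^+ n * (2 * (q + r)) by apply: ler_wpM2l.
    by apply: (le_trans h3); lra.
  rewrite [_ * 2 ^+ n]mulrC; apply: (@le_trans _ _
    (2%:E * (\sum_(n <= i < n + j) dd i x)%E)%E).
    by rewrite sumEFin -EFinM lee_fin.
  apply: lee_wpmul2l => //; rewrite /S.
  apply: (@le_trans _ _ (\sum_(0 <= i < n + j) dd i x)%E).
    rewrite [leRHS](big_cat_nat (n := n)) ?leq_addr//=.
    by rewrite leeDr// sume_ge0.
  exact: nneseries_lim_ge.
pose E := D `&` [set x | S x \is a fin_num].
have mE : measurable E by exact: emeasurable_fin_num.
(* Cutting off where S is infinite makes the sequence converge at every point of D, so the limit is
   measurable without discarding a null set. *)
pose h n x := u n x * \1_E x.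
pose l x := lim (h n x @[n --> \oo]).
have Eh x n : E x -> h n x = u n x by move=> Ex; rewrite /h indicE mem_set// mulr1.
have fast x : E x -> forall n j, (u (n + j)%N x - u n x) ^+ 2 <= 2 * fine (S x) / 2 ^+ n.
  move=> [Dx Sx] n j; rewrite ler_pdivlMr ?exprn_gt0// -lee_fin.
  by rewrite [X in (_ <= X)%E]EFinM fineK.
have hcvg x : D x -> h n x @[n --> \oo] --> l x.
  move=> Dx; have [Ex|nEx] := pselect (E x).
    have [cu _] := fast_cauchy_cvg (fast x Ex).
    by apply: cvgP; under eq_fun do rewrite Eh//; exact: cu.
  apply: cvgP; rewrite /h; under eq_fun do rewrite indicE memNset// mulr0.
  exact: is_cvg_cst.
have ml : measurable_fun D l.
  apply: measurable_fun_cvg hcvg => n; apply: measurable_funM.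
    exact: L2_measurable.
  by apply: measurable_funTS; exact: measurable_indic.
have le n x : D x -> (((u n x - l x) ^+ 2)%:E <= (2 / 2 ^+ n)%:E * S x)%E.
  move=> Dx; have [Ex|nEx] := pselect (E x).
    have [_ /(_ n)] := fast_cauchy_cvg (fast x Ex).
    have -> : lim (u^~ x @ \oo) = l x.
      by rewrite /l; congr (lim _); under [in RHS]eq_fun do rewrite Eh//.
    rewrite -sqrrN opprB -lee_fin => /le_trans; apply.
    by case: Ex => _ Sx; rewrite mulrAC EFinM fineK.
  (* Outside E the right-hand side is infinite and the bound is trivial. *)
  suff -> : S x = +oo%E by rewrite gt0_muley ?leey// lte_fin divr_gt0// exprn_gt0.
  have : S x \isn't a fin_num by apply/negP => Sx; apply: nEx.
  by rewrite ge0_fin_numE// -leNgt leye_eq => /eqP.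
have ile n : (\int[mu]_(x in D) ((u n x - l x) ^+ 2)%:E <= (4 * C / 2 ^+ n)%:E)%E.
  apply: (@le_trans _ _ (\int[mu]_(x in D) ((2 / 2 ^+ n)%:E * S x))%E).
    apply: ge0_le_integral => //.
    - by move=> x _; rewrite lee_fin sqr_ge0.
    - apply/measurable_EFinP; apply: measurable_funX.
      by apply: measurable_funB => //; exact: L2_measurable.
    - exact: measurable_funeM.
    exact: le.
  rewrite ge0_integralZl// ?lee_fin ?divr_ge0//.
  apply: (@le_trans _ _ ((2 / 2 ^+ n)%:E * (2 * C)%:E)%E).
    by apply: lee_wpmul2l => //; rewrite lee_fin divr_ge0.
  by rewrite -EFinM lee_fin (_ : _ / _ * _ = 4 * C / 2 ^+ n)//; ring.
exists l, (4 * C); split.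
  (* Square integrability of l is inherited from u_0, the difference being controlled by the case n
     = 0 of the rate. *)
  have L0 : L2 (fun x => u 0%N x - l x).
    apply/L2P; split.
      by apply: measurable_funB => //; exact: L2_measurable.
    apply/integrableP; split.
      apply/measurable_EFinP; apply: measurable_funX.
      by apply: measurable_funB => //; exact: L2_measurable.
    under eq_integral => x _ do rewrite /= ger0_norm ?sqr_ge0//.
    by apply: le_lt_trans (ile 0%N) _; rewrite ltry.
  have := L2B (uL 0%N) L0.
  by under eq_fun do rewrite opprB addrC subrK.
move=> n; rewrite -lee_fin /Rintegral fineK ?ile//.
rewrite ge0_fin_numE; first by apply: le_lt_trans (ile n) _; rewrite ltry.
by apply: integral_ge0 => x _; rewrite lee_fin sqr_ge0.
Qed.

End L2.

(** * Square integrable tensor fields *)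

Section Frobenius.
Context {R : realType}.

Lemma frobC m n (A B : 'M[R]_(m, n)) : frob A B = frob B A.
Proof. by apply: eq_bigr => i _; apply: eq_bigr => j _; rewrite mulrC. Qed.

Lemma frobZD m n (a : R) (A B C : 'M[R]_(m, n)) :
  frob (a *: A + B) C = a * frob A C + frob B C.
Proof.
rewrite /frob mulr_sumr -big_split; apply: eq_bigr => i _ /=.
rewrite mulr_sumr -big_split; apply: eq_bigr => j _ /=.
by rewrite !mxE mulrDl mulrA.
Qed.

Lemma frob_ge0 m n (A : 'M[R]_(m, n)) : 0 <= frob A A.
Proof. by do 2![apply: sumr_ge0 => ? _]; exact: sqr_ge0. Qed.

Lemma frob_eq0 m n (A : 'M[R]_(m, n)) : frob A A = 0 -> A = 0.
Proof.
move=> A0; apply/matrixP => i j; rewrite mxE; apply/eqP; rewrite -sqrf_eq0.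
have s0 k : 0 <= \sum_l A k l * A k l by apply: sumr_ge0 => l _; exact: sqr_ge0.
have Ai : \sum_l A i l * A i l = 0 by exact: (psumr_eq0P (fun k _ => s0 k) A0).
by apply/eqP; exact: (psumr_eq0P (fun l _ => sqr_ge0 (A i l)) Ai).
Qed.

Lemma enorm_sqr m n (A : 'M[R]_(m, n)) : enorm A ^+ 2 = frob A A.
Proof. by rewrite sqr_sqrtr// frob_ge0. Qed.

Lemma sum2E (f : 'I_2 -> R) : \sum_i f i = f 0 + f 1.
Proof.
rewrite !big_ord_recl big_ord0 addr0; congr (f _ + f _); exact: val_inj.
Qed.

Lemma frob2E (A B : 'M[R]_2) : frob A B =
  A 0 0 * B 0 0 + A 0 1 * B 0 1 + (A 1 0 * B 1 0 + A 1 1 * B 1 1).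
Proof. by rewrite /frob !(sum2E, addr0). Qed.

Lemma tr2E (A : 'M[R]_2) : \tr A = A 0 0 + A 1 1.
Proof. by rewrite /mxtrace sum2E. Qed.

Lemma frob_devl (A B : 'M[R]_2) : frob (deviator A) B = frob A (deviator B).
Proof. by rewrite !frob2E /deviator !mxE !tr2E/=; field. Qed.

Lemma frob_dev_le (A : 'M[R]_2) : frob (deviator A) (deviator A) <= frob A A.
Proof.
suff -> : frob A A = frob (deviator A) (deviator A) + 2^-1 * (\tr A) ^+ 2.
  by rewrite lerDl mulr_ge0// sqr_ge0.
by rewrite !frob2E /deviator !mxE !tr2E/=; field.
Qed.

Lemma devZD (a : R) (A B : 'M[R]_2) :
  deviator (a *: A + B) = a *: deviator A + deviator B.
Proof.
rewrite /deviator !tr2E; apply/matrixP => i j; rewrite !mxE.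
by case: (i == j); rewrite ?mulr1n ?mulr0n; ring.
Qed.

Lemma frob_tensor (v w : 'rV[R]_2) :
  frob (tensor v w) (tensor v w) = frob v v * frob w w.
Proof.
rewrite frob2E /tensor !mxE /frob !big_ord1 !sum2E !mxE/=.
by ring.
Qed.

Lemma tensorZD (a : R) (v v' w : 'rV[R]_2) :
  tensor (a *: v + v') w = a *: tensor v w + tensor v' w.
Proof. by rewrite /tensor linearP/= mulmxDl scalemxAl. Qed.

Lemma frob_trace (A : 'M[R]_2) : \tr A = frob A 1%:M.
Proof. by rewrite frob2E !mxE tr2E/=; ring. Qed.

End Frobenius.

(** * Almost everywhere statements and the essential supremum *)

Section AlmostEverywhere.
Context d (T : measurableType d) (R : realType) (mu : {measure set T -> \bar R}).

(** Monotonicity with the measurable type as an explicit argument, so that [plane R] can be imposed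
    where inference would choose the other instance. *)
Lemma ae_imp (P Q : T -> Prop) : (forall x, P x -> Q x) ->
  {ae mu, forall x, P x} -> {ae mu, forall x, Q x}.
Proof. by move=> PQ; apply: filterS. Qed.

Lemma ae_imp2 (P Q S : T -> Prop) : (forall x, P x -> Q x -> S x) ->
  {ae mu, forall x, P x} -> {ae mu, forall x, Q x} -> {ae mu, forall x, S x}.
Proof. by move=> PQS; apply: filterS2. Qed.

Lemma ae_mu0 (P : T -> Prop) : mu setT = 0 -> {ae mu, forall x, P x}.
Proof. by move=> mu0; exists setT; split. Qed.

Lemma Lnormoo_lty (g : T -> R) : ('N[mu]_+oo[EFin \o g] < +oo)%E ->
  {ae mu, forall x, `|g x| <= fine 'N[mu]_+oo[EFin \o g]}.
Proof.
(* The norm is defined by cases on the total measure; on a null space every property holds almost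
   everywhere. *)
rewrite unlock; case: ifPn => [mu0 Sfin|]; last first.
  rewrite -leNgt measure_le0 => /eqP mu0 _; exact: ae_mu0.
have S0 : (0 <= ess_sup mu (abse \o (EFin \o g)))%E.
  by apply: ess_sup_gee => //; apply: nearW => x; exact: abse_ge0.
have := ess_sup_ge mu (abse \o (EFin \o g)); apply: ae_imp => x /=.
by rewrite -[X in (_ <= X)%E]fineK ?lee_fin// ge0_fin_numE.
Qed.

Lemma ae_le_Lnormoo (g : T -> R) (M : R) : {ae mu, forall x, `|g x| <= M} ->
  ('N[mu]_+oo[EFin \o g] < +oo)%E.
Proof.
move=> gM; rewrite unlock; case: ifP => // _.
apply: (@le_lt_trans _ _ M%:E); last exact: ltry.
apply/ess_supP; apply: ae_imp gM => x /=; by rewrite lee_fin.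
Qed.

End AlmostEverywhere.

(** * The L^2 inner product of vector and tensor fields *)

Section Fields.
Context {R : realType} (Om : set (R * R)).
Hypotheses (mOm : pmeasurable Om) (finOm : (lebesgue2 R Om < +oo)%E).
Local Notation mu := (lebesgue2 R).
Local Notation field m n := (R * R -> 'M[R]_(m, n)).

Definition field_ip m n (F G : field m n) := integ Om (fun x => frob (F x) (G x)).
Local Notation ip := (@field_ip _ _).

Section Dim.
Variables m n : nat.
Implicit Types F G H : field m n.

Lemma frob_integrable F G : in_Lp Om 2%:E F -> in_Lp Om 2%:E G ->
  mu.-integrable Om (EFin \o (fun x => frob (F x) (G x))).
Proof.
move=> LF LG.
have -> : EFin \o (fun x => frob (F x) (G x)) =
    (fun x => (\sum_i \sum_j (F x i j * G x i j)%:E)%E).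
  apply/funext => x /=; rewrite /frob -sumEFin.
  by apply: eq_bigr => i _; rewrite sumEFin.
apply: integrable_sum => // i _; apply: integrable_sum => // j _.
exact: (L2M mOm (LF i j) (LG i j)).
Qed.

Lemma in_LpZD (a : R) F G : in_Lp Om 2%:E F -> in_Lp Om 2%:E G ->
  in_Lp Om 2%:E (a *: F + G).
Proof.
move=> LF LG i j.
have -> : (fun x => (a *: F + G) x i j) = (fun x => a * F x i j + G x i j).
  by apply/funext => x; rewrite !mxE.
exact: (L2ZD mOm a (LF i j) (LG i j)).
Qed.

Lemma in_Lp0 : in_Lp Om 2%:E (0 : field m n).
Proof.
move=> i j; have -> : (fun x => (0 : field m n) x i j) = cst 0.
  by apply/funext => x; rewrite mxE.
exact: (@L2_0 _ (plane R) R mu Om mOm).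
Qed.

Lemma ipC F G : ip F G = ip G F.
Proof. by congr (Rintegral _ _ _); apply/funext => x; exact: frobC. Qed.

Lemma ip_ge0 F : 0 <= ip F F.
Proof. by apply: Rintegral_ge0 => x _; exact: frob_ge0. Qed.

Lemma ipZD (a : R) F G H : in_Lp Om 2%:E F -> in_Lp Om 2%:E G ->
  in_Lp Om 2%:E H -> ip (a *: F + G) H = a * ip F H + ip G H.
Proof.
move=> LF LG LH; rewrite /ip /integ.
have iF := frob_integrable LF LH; have iG := frob_integrable LG LH.
under eq_Rintegral do rewrite frobZD.
rewrite RintegralD//; first by rewrite RintegralZl.
exact: (integrableZl mOm a iF).
Qed.

Lemma ip_inner : semi_inner (in_Lp Om 2%:E) (@field_ip m n).
Proof.
split.
- exact: in_Lp0.
- exact: in_LpZD.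
- by move=> F G _ _; exact: ipC.
- exact: ipZD.
- by move=> F _; exact: ip_ge0.
Qed.

Lemma ip_CS F G : in_Lp Om 2%:E F -> in_Lp Om 2%:E G ->
  ip F G ^+ 2 <= ip F F * ip G G.
Proof. exact: (semi_inner_CS ip_inner). Qed.

Lemma ip_sum F G : in_Lp Om 2%:E F -> in_Lp Om 2%:E G ->
  ip F G = \sum_i \sum_j \int[mu]_(x in Om) (F x i j * G x i j).
Proof.
move=> LF LG; rewrite /ip /integ /Rintegral.
have iFG i j := L2M mOm (LF i j) (LG i j).
have -> : (\int[mu]_(x in Om) (frob (F x) (G x))%:E =
    \sum_i \sum_j \int[mu]_(x in Om) (F x i j * G x i j)%:E)%E.
  have iFGi i : mu.-integrable Om (fun x => (\sum_j (F x i j * G x i j)%:E)%E).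
    by apply: integrable_sum => // j _; exact: iFG.
  transitivity (\int[mu]_(x in Om) (\sum_i \sum_j (F x i j * G x i j)%:E)%E)%E.
    apply: eq_integral => x _; rewrite /frob -sumEFin.
    by apply: eq_bigr => i _; rewrite sumEFin.
  rewrite integral_sum//; apply: eq_bigr => i _.
  by rewrite integral_sum//; exact: iFG.
suff -> : (\sum_i \sum_j \int[mu]_(x in Om) (F x i j * G x i j)%:E =
    (\sum_i \sum_j (\int[mu]_(x in Om) (F x i j * G x i j))%R)%R%:E)%E by [].
rewrite -sumEFin; apply: eq_bigr => i _; rewrite -sumEFin; apply: eq_bigr => j _.
by rewrite fineK//; exact: integrable_fin_num (iFG i j).
Qed.

(** Entrywise from the scalar case: the squared increment of one entry is a term of a sum of
    nonnegative terms. *)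
Lemma ip_complete : fast_complete (in_Lp Om 2%:E) (@field_ip m n).
Proof.
move=> u C uL uC.
have dL k : in_Lp Om 2%:E (u k.+1 - u k).
  by rewrite addrC -scaleN1r; exact: in_LpZD.
have comp i j : exists lK : (R * R -> R) * R, @L2 _ (plane R) R mu Om lK.1 /\
    forall k, \int[mu]_(x in Om) (u k x i j - lK.1 x) ^+ 2 <= lK.2 / 2 ^+ k.
  have [|k|l [K [Ll lK]]] := @L2_complete _ (plane R) R mu Om mOm
      (fun k x => u k x i j) C.
  - by move=> k; exact: uL.
  - apply: le_trans (uC k); rewrite ip_sum// (bigD1 i)//= (bigD1 j)//=.
    under eq_Rintegral do rewrite expr2.
    under [in leRHS]eq_Rintegral do rewrite !mxE.
    rewrite -addrA lerDl addr_ge0//.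
      by apply: sumr_ge0 => j' _; apply: Rintegral_ge0 => x _; exact: sqr_ge0.
    apply: sumr_ge0 => i' _; apply: sumr_ge0 => j' _.
    by apply: Rintegral_ge0 => x _; exact: sqr_ge0.
  - by exists (l, K).
have [l' lP'] := choice (fun ij : 'I_m * 'I_n => comp ij.1 ij.2).
pose l i j := l' (i, j); have lP i j := lP' (i, j).
pose F : field m n := fun x => \matrix_(i, j) (l i j).1 x.
have FL : in_Lp Om 2%:E F.
  move=> i j; have -> : (fun x => F x i j) = (l i j).1.
    by apply/funext => x; rewrite mxE.
  by case: (lP i j).
exists F, (\sum_i \sum_j (l i j).2); split => // k.
rewrite ip_sum; [|by rewrite addrC -scaleN1r; exact: in_LpZD..].
rewrite mulr_suml; apply: ler_sum => i _; rewrite mulr_suml; apply: ler_sum => j _.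
have [_ /(_ k)] := lP i j; apply: le_trans; under eq_Rintegral do rewrite !mxE.
by under [leRHS]eq_Rintegral do rewrite expr2.
Qed.

Lemma Lp_normE F : Lp_norm Om 2%:E F = Num.sqrt (ip F F).
Proof.
rewrite /Lp_norm unlock fine_poweR -powR12_sqrt; last exact: ip_ge0.
congr (_ `^ _); congr fine; rewrite [RHS]integral_mkcond.
apply: eq_integral => x _; rewrite /= !patchE; case: ifP => _.
  by rewrite powR_mulrn// real_normK ?num_real// enorm_sqr.
by rewrite normr0 powR0.
Qed.

Lemma ip_eq0_ae F : in_Lp Om 2%:E F -> ip F F = 0 ->
  {ae mu, forall x, Om x -> F x = 0}.
Proof.
move=> LF F0; have iF := frob_integrable LF LF.
have : (\int[mu]_(x in Om) `|(EFin \o (fun x => frob (F x) (F x))) x| = 0)%E.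
  under eq_integral => x _ do rewrite /= ger0_norm ?frob_ge0//.
  rewrite -[LHS]fineK; last exact: integrable_fin_num iF.
  by rewrite -[fine _]/(ip F F) F0.
move/(ae_eq_integral_abs mu mOm (measurable_int _ iF)).
by apply: (@ae_imp _ (plane R)) => x /= + Omx => /(_ Omx) [/frob_eq0].
Qed.

Lemma ip_ae F F' G : in_Lp Om 2%:E F -> in_Lp Om 2%:E F' ->
  in_Lp Om 2%:E G -> {ae mu, forall x, Om x -> F x = F' x} -> ip F G = ip F' G.
Proof.
move=> LF LF' LG FF'; rewrite /ip /integ /Rintegral; congr fine.
apply: ae_eq_integral => //.
- exact: measurable_int (frob_integrable LF LG).
- exact: measurable_int (frob_integrable LF' LG).
- by apply: (@ae_imp _ (plane R)) FF' => x /= + Omx => /(_ Omx) ->.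
Qed.

Lemma L2_in_Lp (g : R * R -> R) (E : 'M[R]_(m, n)) :
  @L2 _ (plane R) R mu Om g -> in_Lp Om 2%:E (fun x => g x *: E).
Proof.
move=> Lg i j; have -> : (fun x => (g x *: E) i j) = (fun x => E i j * g x).
  by apply/funext => x; rewrite mxE mulrC.
exact: (L2Z mOm (E i j) Lg).
Qed.

End Dim.

Implicit Types (t : field 2 2) (v w : field 1 2).

Lemma in_Lp_dev t : in_Lp Om 2%:E t -> in_Lp Om 2%:E (fun x => deviator (t x)).
Proof.
move=> Lt i j.
have -> : (fun x => deviator (t x) i j) =
    (fun x => (- 2^-1 * (i == j)%:R) * (t x 0 0 + t x 1 1) + t x i j).
  by apply/funext => x; rewrite /deviator !mxE tr2E; case: (i == j); ring.
exact: (L2ZD mOm _ (L2D mOm (Lt 0 0) (Lt 1 1)) (Lt i j)).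
Qed.

Lemma ip_dev_le t : in_Lp Om 2%:E t ->
  ip (fun x => deviator (t x)) (fun x => deviator (t x)) <= ip t t.
Proof.
move=> Lt; apply: le_Rintegral => //.
- exact: (frob_integrable (in_Lp_dev Lt) (in_Lp_dev Lt)).
- exact: frob_integrable.
- by move=> x _; exact: frob_dev_le.
Qed.

Lemma dev_fieldZD (a : R) t s : (fun x => deviator ((a *: t + s) x)) =
  a *: (fun x => deviator (t x)) + (fun x => deviator (s x)).
Proof. by apply/funext => x; exact: devZD. Qed.

Lemma L2_continuous (g : R * R -> R) : bounded_set Om -> continuous g ->
  @L2 _ (plane R) R mu Om g.
Proof.
move=> bOm cg; have [M gM] := continuous_bounded bOm cg.
apply: (@L2_bounded _ (plane R) R mu Om mOm g M) => //.
by apply: measurable_funTS; exact: continuous_measurable2.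
Qed.

Lemma L2_integrable (g : R * R -> R) : @L2 _ (plane R) R mu Om g ->
  mu.-integrable Om (EFin \o g).
Proof.
move=> Lg; have L1 : @L2 _ (plane R) R mu Om (cst 1).
  apply: (@L2_bounded _ (plane R) R mu Om mOm _ 1) => // x _.
  by rewrite /= normr1.
have := L2M mOm Lg L1.
by under eq_fun do rewrite mulr1.
Qed.

Section Essentially_bounded.
Variable beta : field 1 2.
Hypothesis beta_oo : in_Lp Om +oo%E beta.
Let B := Lp_norm Om +oo%E beta.

Lemma Loo_measurable j : measurable_fun (Om : set (plane R)) (fun x => beta x 0 j).
Proof.
apply/(measurable_restrictT _ mOm).
by have := sub_Lfun_mfun (beta_oo 0 j); rewrite inE.
Qed.

(** [in_Lp] bounds the entries, whereas [Lp_norm] measures the Euclidean length, and [fine] would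
    turn an infinite norm into a meaningless value. Finiteness is therefore deduced first, from
    bounds on the two entries. *)
Lemma Loo_enorm_le : 0 <= B /\ {ae mu, forall x, Om x -> enorm (beta x) <= B}.
Proof.
split; first by rewrite /B /Lp_norm fine_ge0// Lnorm_ge0.
have comp j : exists M : R, {ae mu, forall x, Om x -> `|beta x 0 j| <= M}.
  have := sub_Lfun_finLfun (beta_oo 0 j); rewrite inE/= => /Lnormoo_lty H.
  eexists; apply: (@ae_imp _ (plane R)) H => x /= H Omx; apply: le_trans H.
  by rewrite patchE mem_set.
have [M0 H0] := comp 0; have [M1 H1] := comp 1.
have /Lnormoo_lty : ('N[mu]_+oo[EFin \o ((fun x => enorm (beta x)) \_ Om)] < +oo)%E.
  apply: (@ae_le_Lnormoo _ (plane R) _ _ _ (Num.sqrt (M0 ^+ 2 + M1 ^+ 2))).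
  apply: (@ae_imp2 _ (plane R)) H0 H1 => x H0 H1; rewrite patchE.
  case: ifPn => [/set_mem Omx|_]; last by rewrite normr0 sqrtr_ge0.
  rewrite ger0_norm ?sqrtr_ge0// ler_wsqrtr// /frob big_ord1 sum2E -!expr2.
  rewrite -(real_normK (num_real (beta x 0 0))) -(real_normK (num_real (beta x 0 1))).
  by apply: lerD; rewrite lerXn2r ?nnegrE ?H0 ?H1//
    (le_trans _ (H0 Omx), le_trans _ (H1 Omx)).
apply: (@ae_imp _ (plane R)) => x /= H Omx; apply: le_trans H.
by rewrite patchE mem_set// ger0_norm ?sqrtr_ge0.
Qed.

Lemma tensor_measurable v i j : in_Lp Om 2%:E v ->
  measurable_fun (Om : set (plane R)) (fun x => v x 0 i * beta x 0 j).
Proof.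
move=> Lv; apply: measurable_funM; last exact: Loo_measurable.
exact: (L2_measurable mOm (Lv 0 i)).
Qed.

Lemma in_Lp_tensor v : in_Lp Om 2%:E v ->
  in_Lp Om 2%:E (fun x => tensor (v x) (beta x)).
Proof.
move=> Lv i j; have [B0 betaB] := Loo_enorm_le.
have -> : (fun x => tensor (v x) (beta x) i j) = (fun x => v x 0 i * beta x 0 j).
  by apply/funext => x; rewrite /tensor !mxE big_ord1 !mxE.
have m := tensor_measurable i j Lv.
apply/(L2P _ mOm); split => //; apply/integrableP; split.
  by apply/measurable_EFinP; exact: measurable_funX.
have iv := L2_sqr mOm (L2Z mOm B (Lv 0 i)).
apply: le_lt_trans (integrable_lty mOm iv).
apply: ae_ge0_le_integral => //.
- apply: measurableT_comp => //; apply/measurable_EFinP; exact: measurable_funX.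
- by move=> x _; rewrite lee_fin sqr_ge0.
- exact: measurable_int iv.
apply: (@ae_imp _ (plane R)) betaB => x betaB Omx /=.
rewrite lee_fin ger0_norm ?sqr_ge0// !exprMn mulrC ler_wpM2r ?sqr_ge0//.
apply: (@le_trans _ _ (enorm (beta x) ^+ 2)); last first.
  by rewrite lerXn2r ?nnegrE ?betaB// sqrtr_ge0.
rewrite enorm_sqr /frob big_ord1 sum2E.
case: j {m} => [[|[|//]]] jlt.
- by rewrite (_ : Ordinal jlt = 0) ?expr2 ?lerDl -?expr2 ?sqr_ge0//; exact: val_inj.
- by rewrite (_ : Ordinal jlt = 1) ?expr2 ?lerDr -?expr2 ?sqr_ge0//; exact: val_inj.
Qed.

Lemma ip_tensor_le v : in_Lp Om 2%:E v ->
  ip (fun x => tensor (v x) (beta x)) (fun x => tensor (v x) (beta x)) <= B ^+ 2 * ip v v.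
Proof.
move=> Lv; have [B0 betaB] := Loo_enorm_le; have Lt := in_Lp_tensor Lv.
have it := frob_integrable Lt Lt; have iv := frob_integrable Lv Lv.
have iBv := integrableZl mOm (B ^+ 2) iv.
rewrite /ip /integ -RintegralZl// /Rintegral fine_le//.
- exact: integrable_fin_num it.
- exact: integrable_fin_num iBv.
apply: ae_ge0_le_integral => //.
- by move=> x _; rewrite lee_fin frob_ge0.
- exact: measurable_int it.
- by move=> x _; rewrite lee_fin mulr_ge0 ?sqr_ge0 ?frob_ge0.
- exact: measurable_int iBv.
apply: (@ae_imp _ (plane R)) betaB => x betaB Omx /=.
rewrite lee_fin frob_tensor mulrC ler_wpM2r ?frob_ge0// -enorm_sqr.
by rewrite lerXn2r ?nnegrE ?betaB// sqrtr_ge0.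
Qed.

End Essentially_bounded.
End Fields.

(** * The space H_0(div) *)

Section Hdiv.
Context {R : realType} (Om : set (R * R)).
Hypotheses (oOm : open Om) (bOm : bounded_set Om).
Local Notation mu := (lebesgue2 R).
Local Notation field m n := (R * R -> 'M[R]_(m, n)).
Local Notation ip := (@field_ip R Om _ _).
Local Notation L2f := (in_Lp Om 2%:E).

Let mOm : pmeasurable Om. Proof. exact: open_measurable2. Qed.
Let finOm : (mu Om < +oo)%E. Proof. exact: bounded_lty. Qed.

Implicit Types (t s : field 2 2) (v w : field 1 2) (phi : R * R -> R).

Lemma smooth_continuous phi : smooth phi -> continuous phi.
Proof. by move=> sphi x; exact/differentiable_continuous/(sphi [::]). Qed.

Lemma smooth_partial_continuous phi j : smooth phi -> continuous (partial j phi).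
Proof. by move=> sphi x; exact/differentiable_continuous/(sphi [:: j]). Qed.

(** Row i is the gradient of phi and the other row is zero. Together with [test_val] it writes the
    weak divergence as an identity between inner products with fixed fields, which is visibly linear
    and stable under L^2 limits. *)
Definition test_grad phi (i : 'I_2) : field 2 2 :=
  fun x => \matrix_(k, j) ((k == i)%:R * partial j phi x).

Definition test_val phi (i : 'I_2) : field 1 2 := fun x => phi x *: delta_mx 0 i.

Lemma in_Lp_test_grad phi i : test_function Om phi -> L2f (test_grad phi i).
Proof.
move=> [sphi _ _] k j.
have -> : (fun x => test_grad phi i x k j) = (fun x => (k == i)%:R * partial j phi x).
  by apply/funext => x; rewrite mxE.
apply: (L2Z mOm); apply: L2_continuous => //; exact: smooth_partial_continuous.
Qed.

Lemma in_Lp_test_val phi i : test_function Om phi -> L2f (test_val phi i).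
Proof.
move=> [sphi _ _]; apply: L2_in_Lp => //; apply: L2_continuous => //.
exact: smooth_continuous.
Qed.

Lemma frob_test_grad t phi i x :
  frob (t x) (test_grad phi i x) = \sum_j t x i j * partial j phi x.
Proof.
rewrite /frob (bigD1 i)//= [X in _ + X]big1 ?addr0 => [|k ki].
  by apply: eq_bigr => j _; rewrite mxE eqxx mul1r.
by apply: big1 => j _; rewrite mxE (negbTE ki) mul0r mulr0.
Qed.

Lemma frob_test_val w phi i x : frob (w x) (test_val phi i x) = w x 0 i * phi x.
Proof.
rewrite /frob big_ord1 (bigD1 i)//= [X in _ + X]big1 ?addr0 => [|k ki].
  by rewrite !mxE !eqxx mulr1.
by rewrite !mxE (negbTE ki) mulr0 mulr0.
Qed.

Lemma is_weak_divP t w : is_weak_div Om t w <-> L2f w /\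
  forall phi, test_function Om phi -> forall i,
    ip t (test_grad phi i) = - ip w (test_val phi i).
Proof.
rewrite /is_weak_div.
suff E phi i : (integ Om (fun x => \sum_j t x i j * partial j phi x) =
     ip t (test_grad phi i)) /\
    (integ Om (fun x => w x 0 i * phi x) = ip w (test_val phi i)).
  by split=> -[Lw H]; split => // phi tphi i; have := H phi tphi i;
    have [-> ->] := E phi i.
split; apply: eq_Rintegral => x _; last by rewrite frob_test_val.
by rewrite frob_test_grad.
Qed.

Lemma weak_div_unique t w w' : is_weak_div Om t w -> is_weak_div Om t w' ->
  {ae mu, forall x, Om x -> w x = w' x}.
Proof.
move=> [Lw wP] [Lw' wP'].
have comp i : {ae mu, forall x, Om x -> w x 0 i - w' x 0 i = 0}.
  have Lg := L2B mOm (Lw 0 i) (Lw' 0 i).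
  apply: test_function_ae0 => //; first exact: L2_integrable.
  move=> phi tphi; have [sphi _ _] := tphi.
  have Lphi := L2_continuous mOm finOm bOm (smooth_continuous sphi).
  have := wP phi tphi i; rewrite (wP' phi tphi i) => /oppr_inj E.
  rewrite /integ; under eq_Rintegral do rewrite mulrBl.
  rewrite RintegralB//; first by apply/eqP; rewrite subr_eq0; apply/eqP.
  - exact: (L2M mOm (Lw 0 i) Lphi).
  - exact: (L2M mOm (Lw' 0 i) Lphi).
apply: (@ae_imp2 _ (plane R)) (comp 0) (comp 1) => x H0 H1 Omx.
apply/rowP => i; apply/eqP; rewrite -subr_eq0; apply/eqP.
case: i => [[|[|//]]] lt.
- by rewrite (_ : Ordinal lt = 0) ?H0//; exact: val_inj.
- by rewrite (_ : Ordinal lt = 1) ?H1//; exact: val_inj.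
Qed.

(** Once a weak divergence exists, [xget] returns one, and any two agree almost everywhere; so in a
    pairing w can stand for [wdiv]. *)
Lemma ip_wdiv t w v : L2f v -> is_weak_div Om t w -> ip (wdiv Om t) v = ip w v.
Proof.
move=> Lv tw; have tw' : is_weak_div Om t (wdiv Om t) by apply: xgetPex; exists w.
apply: ip_ae => //; [by case: tw'|by case: tw|exact: weak_div_unique tw' tw].
Qed.

Lemma ip_wdiv2 t w : is_weak_div Om t w ->
  ip (wdiv Om t) (wdiv Om t) = ip w w.
Proof.
move=> tw; have tw' : is_weak_div Om t (wdiv Om t) by apply: xgetPex; exists w.
rewrite (ip_wdiv _ tw); last by case: tw'.
by rewrite ipC (ip_wdiv _ tw)//; case: tw.
Qed.

(* H_0(div), each field being paired with one of its weak divergences so that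
   the divergence becomes honestly linear. *)
Definition hdiv_pair0 (p : field 2 2 * field 1 2) : Prop :=
  [/\ L2f p.1, is_weak_div Om p.1 p.2 & ip p.1 (cst 1%:M) = 0].

Local Notation hdiv0 := hdiv_pair0.

Lemma in_Lp_cst m n (E : 'M[R]_(m, n)) : L2f (cst E).
Proof.
move=> i j; apply: (@L2_continuous _ Om mOm finOm (cst (E i j)) bOm).
exact: cst_continuous.
Qed.

Lemma in_Hdiv0P t : in_Hdiv0 Om t <-> exists w, hdiv0 (t, w).
Proof.
have E : integ Om (fun x => \tr (t x)) = ip t (cst 1%:M).
  by apply: eq_Rintegral => x _; rewrite frob_trace.
split=> [[[Lt [w tw]] t0]|[w [Lt tw t0]]].
  by exists w; split => //=; rewrite -E.
by split; [split => //; exists w|rewrite E].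
Qed.

Lemma hdiv0_wdiv t : in_Hdiv0 Om t -> hdiv0 (t, wdiv Om t).
Proof.
move=> Ht; have [w [/= Lt tw t0]] := (in_Hdiv0P t).1 Ht.
by split => //=; apply: xgetPex; exists w.
Qed.

Lemma hdiv0_L2 p : hdiv0 p -> L2f p.1 /\ L2f p.2.
Proof. by move=> [? [? _] _]. Qed.

Lemma hdiv0ZD (a : R) p q : hdiv0 p -> hdiv0 q -> hdiv0 (a *: p + q).
Proof.
move=> [Lp /is_weak_divP[Lp2 pP] p0] [Lq /is_weak_divP[Lq2 qP] q0]; split.
- exact: in_LpZD.
- apply/is_weak_divP; split; first exact: in_LpZD.
  move=> phi tphi i; have Lg := in_Lp_test_grad i tphi; have Lv := in_Lp_test_val i tphi.
  by rewrite /= !ipZD// pP// qP//; ring.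
- by rewrite /= ipZD ?p0 ?q0 ?mulr0 ?addr0//; exact: in_Lp_cst.
Qed.

Lemma hdiv00 : hdiv0 0.
Proof.
have ip0 m n (F : field m n) : ip (0 : field m n) F = 0.
  rewrite /field_ip /integ; under eq_Rintegral.
    move=> x _; rewrite /frob (_ : \sum_i _ = 0).
      over.
    by do 2![apply: big1 => ? _]; rewrite mxE mul0r.
  by rewrite Rintegral_cst// mul0r.
split; [exact: in_Lp0| |exact: ip0].
apply/is_weak_divP; split; first exact: in_Lp0.
by move=> phi tphi i; rewrite !ip0 oppr0.
Qed.

Lemma ipB m n (F G H : field m n) : L2f F -> L2f G -> L2f H ->
  ip (F - G) H = ip F H - ip G H.
Proof. by move=> *; rewrite addrC -scaleN1r ipZD// mulN1r addrC. Qed.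

Lemma in_LpB m n (F G : field m n) : L2f F -> L2f G -> L2f (F - G).
Proof. by move=> *; rewrite addrC -scaleN1r; exact: in_LpZD. Qed.

Lemma ip_fast_lim m n (u : nat -> field m n) (l H : field m n) (K : R) :
  (forall k, L2f (u k)) -> L2f l -> L2f H ->
  (forall k, ip (u k - l) (u k - l) <= K / 2 ^+ k) ->
  forall k, (ip (u k) H - ip l H) ^+ 2 <= K * ip H H / 2 ^+ k.
Proof.
move=> uL lL HL uK k; rewrite -ipB//.
apply: (le_trans (ip_CS mOm (in_LpB (uL k) lL) HL)).
by rewrite [leRHS]mulrAC; apply: ler_wpM2r => //; exact: ip_ge0.
Qed.

(** A linear relation passes to L^2 limits. The two summands have independent dimensions because the
    weak divergence relates a tensor field to a vector field. *)
Lemma ip_fast_closed m n m' n' (u : nat -> field m n) (l H : field m n)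
    (u' : nat -> field m' n') (l' H' : field m' n') (K K' : R) :
  (forall k, L2f (u k)) -> L2f l -> L2f H ->
  (forall k, L2f (u' k)) -> L2f l' -> L2f H' ->
  (forall k, ip (u k - l) (u k - l) <= K / 2 ^+ k) ->
  (forall k, ip (u' k - l') (u' k - l') <= K' / 2 ^+ k) ->
  (forall k, ip (u k) H + ip (u' k) H' = 0) -> ip l H + ip l' H' = 0.
Proof.
move=> uL lL HL uL' lL' HL' uK uK' u0.
apply/eqP; rewrite -sqrf_eq0 eq_le sqr_ge0 andbT.
apply: (@le0_geometric _ _ (2 * (K * ip H H + K' * ip H' H'))) => k.
have -> : ip l H + ip l' H' = - (ip (u k) H - ip l H) + - (ip (u' k) H' - ip l' H').
  by have := u0 k => /eqP; rewrite addr_eq0 => /eqP ->; ring.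
apply: (le_trans (sqrrD_le _ _)); rewrite !sqrrN.
have h1 := ip_fast_lim uL lL HL uK k; have h2 := ip_fast_lim uL' lL' HL' uK' k.
rewrite (_ : 2 * _ / _ = 2 * (K * ip H H / 2 ^+ k + K' * ip H' H' / 2 ^+ k));
  last by ring.
by rewrite ler_pM2l// lerD.
Qed.

(** * The energy inner product on H_0(div) *)

Section Energy.
Variables (nu kappa C1 : R).
Hypotheses (nu_gt0 : 0 < nu) (kappa_gt0 : 0 < kappa) (C1_gt0 : 0 < C1).
Hypothesis C1P : deviator_bound Om C1.

Local Notation dev t := (fun x => deviator (t x)).

Definition energy_form (p q : field 2 2 * field 1 2) : R :=
  nu^-1 * ip (dev p.1) (dev q.1) + kappa^-1 * ip p.2 q.2.

Local Notation energy := energy_form.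

Lemma hdiv0_C1 p : hdiv0 p ->
  C1 * ip p.1 p.1 <= ip (dev p.1) (dev p.1) + ip p.2 p.2.
Proof.
case: p => t w tw; have /C1P : in_Hdiv0 Om t by apply/in_Hdiv0P; exists w.
rewrite !Lp_normE !sqr_sqrtr ?ip_ge0// (ip_wdiv2 (w := w))//.
by case: tw.
Qed.

Lemma energy_inner : semi_inner hdiv0 energy.
Proof.
split.
- exact: hdiv00.
- exact: hdiv0ZD.
- by move=> p q _ _; rewrite /energy_form (ipC _ (dev p.1)) (ipC _ p.2).
- move=> a p q r /hdiv0_L2[? ?] /hdiv0_L2[? ?] /hdiv0_L2[? ?].
  rewrite /energy_form dev_fieldZD ipZD//; try exact: in_Lp_dev.
  by rewrite ipZD//; do !move: (ip _ _) => ?; ring.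
- by move=> p _; rewrite addr_ge0// mulr_ge0 ?invr_ge0 ?ip_ge0// ltW.
Qed.

Lemma dev_le_energy p : ip (dev p.1) (dev p.1) <= nu * energy p p.
Proof.
rewrite /energy_form mulrDr mulVKf ?gt_eqF// lerDl.
by rewrite !mulr_ge0 ?invr_ge0 ?ip_ge0// ltW.
Qed.

Lemma div_le_energy p : ip p.2 p.2 <= kappa * energy p p.
Proof.
rewrite /energy_form mulrDr mulVKf ?gt_eqF// lerDr.
by rewrite !mulr_ge0 ?invr_ge0 ?ip_ge0// ltW.
Qed.

(** The energy bounds the divergence directly and the field through [C1], so both components
    converge in L^2. The limit stays in the space because membership is expressed by pairings with
    fixed fields. *)
Lemma energy_complete : fast_complete hdiv0 energy.
Proof.
move=> u C uD uC.
have uL k : L2f (u k).1 /\ L2f (u k).2 := hdiv0_L2 (uD k).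
have dD k : hdiv0 (u k.+1 - u k).
  by rewrite addrC -scaleN1r; exact: hdiv0ZD.
have c2 k : ip ((u k.+1).2 - (u k).2) ((u k.+1).2 - (u k).2) <= kappa * C / 4 ^+ k.
  apply: (le_trans (div_le_energy (u k.+1 - u k))); rewrite -mulrA.
  by apply: ler_wpM2l => //; exact: ltW.
have c1 k : ip ((u k.+1).1 - (u k).1) ((u k.+1).1 - (u k).1) <=
    C1^-1 * (nu + kappa) * C / 4 ^+ k.
  rewrite -!mulrA ler_pdivlMl//; apply: (le_trans (hdiv0_C1 (dD k))).
  rewrite mulrDl; apply: lerD.
    apply: (le_trans (dev_le_energy (u k.+1 - u k))).
    by apply: ler_wpM2l => //; exact: ltW.
  apply: (le_trans (div_le_energy (u k.+1 - u k))).
  by apply: ler_wpM2l => //; exact: ltW.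
have [t [K [Lt tK]]] := ip_complete mOm (fun k => (uL k).1) c1.
have [w [K' [Lw wK]]] := ip_complete mOm (fun k => (uL k).2) c2.
have uL1 k := (uL k).1; have uL2 k := (uL k).2.
exists (t, w), (nu^-1 * K + kappa^-1 * K'); split.
  split => //=; last first.
    (* The trace condition is a single pairing; it is used twice and the factor 2 is removed at the
       end. *)
    have := @ip_fast_closed _ _ _ _ _ t (cst 1%:M) _ t (cst 1%:M) K K uL1 Lt
      (in_Lp_cst _) uL1 Lt (in_Lp_cst _) tK tK.
    move=> H; have {}H : ip t (cst 1%:M) + ip t (cst 1%:M) = 0.
      by apply: H => k; have [_ _ ->] := uD k; rewrite addr0.
    by lra.
  apply/is_weak_divP; split => // phi tphi i; apply/eqP; rewrite -addr_eq0; apply/eqP.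
  apply: (ip_fast_closed uL1 Lt (in_Lp_test_grad i tphi) uL2 Lw
    (in_Lp_test_val i tphi) tK wK) => k.
  have [_ /is_weak_divP[_ uP] _] := uD k.
  by rewrite uP// addrC subrr.
move=> k; rewrite mulrDl -!mulrA; apply: lerD; apply: ler_wpM2l.
- by rewrite invr_ge0 ltW.
- apply: le_trans (tK k); exact: (ip_dev_le mOm (in_LpB (uL1 k) Lt)).
- by rewrite invr_ge0 ltW.
- exact: wK.
Qed.

End Energy.
End Hdiv.

(** * The variational problem *)

Section WellPosedness.
Context {R : realType} (Om : set (R * R)).
Hypotheses (oOm : open Om) (bOm : bounded_set Om).
Local Notation mu := (lebesgue2 R).
Local Notation field m n := (R * R -> 'M[R]_(m, n)).
Local Notation ip := (@field_ip R Om _ _).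
Local Notation L2f := (in_Lp Om 2%:E).
Local Notation dev t := (fun x => deviator (t x)).

Let mOm : pmeasurable Om. Proof. exact: open_measurable2. Qed.
Let finOm : (mu Om < +oo)%E. Proof. exact: bounded_lty. Qed.

Variables (nu kappa C1 gamma : R) (beta f : field 1 2).
Hypotheses (nu_gt0 : 0 < nu) (kappa_gt0 : 0 < kappa) (C1_gt0 : 0 < C1)
  (gamma_gt0 : 0 < gamma).
Hypotheses (beta_oo : in_Lp Om +oo%E beta) (f_L2 : L2f f).
Hypotheses (C1P : deviator_bound Om C1) (gammaP : inf_sup_b Om gamma).
Let B := Lp_norm Om +oo%E beta.
Hypothesis B_small : 4 * B <= nu * gamma.

Let B_ge0 : 0 <= B. Proof. by case: (Loo_enorm_le beta_oo). Qed.

Local Notation hdiv0 := (hdiv_pair0 Om).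
Local Notation energy := (energy_form Om nu kappa).
Local Notation field_tensor v := (fun x => tensor (v x) (beta x)).

Lemma sqrt_ip_CS m n (F G : field m n) : L2f F -> L2f G ->
  ip F G <= Num.sqrt (ip F F) * Num.sqrt (ip G G).
Proof.
move=> LF LG; rewrite -sqrtrM ?ip_ge0//.
apply: (le_trans (ler_norm _)); rewrite -sqrtr_sqr ler_wsqrtr//.
exact: ip_CS.
Qed.

Lemma Hdiv_normE p : hdiv0 p ->
  Hdiv_norm Om p.1 = Num.sqrt (ip p.1 p.1 + ip p.2 p.2).
Proof.
move=> [Lp pw _]; rewrite /Hdiv_norm !Lp_normE !sqr_sqrtr ?ip_ge0//.
by rewrite (ip_wdiv2 oOm bOm pw).
Qed.

(** The form in which the inf-sup condition is applied: a bound on all pairings with divergences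
    bounds q. *)
Lemma inf_sup_le (q : field 1 2) (c : R) : L2f q -> 0 <= c ->
  (forall p, hdiv0 p -> ip p.2 q <= c * Num.sqrt (ip p.1 p.1 + ip p.2 p.2)) ->
  gamma * Num.sqrt (ip q q) <= c.
Proof.
move=> Lq c0 H; have := gammaP Lq; rewrite Lp_normE => /le_trans h.
rewrite -lee_fin; apply: h; apply: ub_ereal_sup => _ [_ [t [Ht tn0] <-] <-].
rewrite lee_fin; have tD := hdiv0_wdiv Ht.
have N0 : 0 <= Hdiv_norm Om t := sqrtr_ge0 _.
have := H _ tD; rewrite -(Hdiv_normE tD) -[ip _ q]/(form_b Om t q) /=.
(* If the norm is 0, so is the quotient, because the inverse of 0 is 0. *)
move: N0; rewrite le_eqVlt => /predU1P[<-|N0]; first by move=> _; rewrite invr0 mulr0.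
by rewrite ler_pdivrMr.
Qed.

(** The part of c(u, tau) that comes from div sigma in u = kappa^-1 (div sigma + f), with the
    deviator moved to the test field by symmetry. *)
Definition advection (p q : field 2 2 * field 1 2) : R :=
  nu^-1 * ip (field_tensor (kappa^-1 *: p.2)) (dev q.1).

(** What f contributes through the same substitution: the first term comes from b(tau, u), the
    second from c(u, tau), with signs changed. *)
Definition load (q : field 2 2 * field 1 2) : R :=
  - kappa^-1 * ip q.2 f - nu^-1 * ip (field_tensor (kappa^-1 *: f)) (dev q.1).

Lemma in_LpZ m n (a : R) (F : field m n) : L2f F -> L2f (a *: F).
Proof. by move=> LF; rewrite -[a *: F]addr0; apply: in_LpZD => //; exact: in_Lp0. Qed.

Lemma ipZ m n (a : R) (F G : field m n) : L2f F -> L2f G ->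
  ip (a *: F) G = a * ip F G.
Proof.
move=> LF LG; have /eqP := ipZD mOm (-1) LF LF LG.
rewrite scaleN1r addNr mulN1r addNr => /eqP ip0.
rewrite -[a *: F]addr0 ipZD//; last exact: in_Lp0.
by rewrite ip0 addr0.
Qed.

Lemma ipZZ m n (a : R) (F : field m n) : L2f F ->
  ip (a *: F) (a *: F) = a ^+ 2 * ip F F.
Proof.
move=> LF; have LaF := in_LpZ a LF.
by rewrite ipZ// ipC ipZ// mulrA.
Qed.

Lemma field_tensorZD (a : R) (v w : field 1 2) :
  field_tensor (a *: v + w) = a *: field_tensor v + field_tensor w.
Proof. by apply/funext => x; exact: tensorZD. Qed.

Lemma tensor_dev_le (v : field 1 2) (t : field 2 2) : L2f v -> L2f t ->
  ip (field_tensor v) (dev t) ^+ 2 <= B ^+ 2 * ip v v * ip (dev t) (dev t).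
Proof.
move=> Lv Lt.
apply: (le_trans (ip_CS mOm (in_Lp_tensor mOm beta_oo Lv) (in_Lp_dev mOm Lt))).
by apply: ler_wpM2r; [exact: ip_ge0|exact: ip_tensor_le].
Qed.

Lemma load_linear : linear_on hdiv0 load.
Proof.
move=> a p q /hdiv0_L2[? ?] /hdiv0_L2[? ?]; rewrite /load.
have LT : L2f (field_tensor (kappa^-1 *: f)) by apply: in_Lp_tensor => //; exact: in_LpZ.
rewrite !(ipC _ (field_tensor _)) dev_fieldZD !ipZD//; try exact: in_Lp_dev.
by do !move: (ip _ _) => ?; ring.
Qed.

Lemma advection_linear_r p : hdiv0 p -> linear_on hdiv0 (advection p).
Proof.
move=> /hdiv0_L2[? ?] a q r /hdiv0_L2[? ?] /hdiv0_L2[? ?]; rewrite /advection.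
have LT : L2f (field_tensor (kappa^-1 *: p.2)).
  by apply: in_Lp_tensor => //; exact: in_LpZ.
rewrite !(ipC _ (field_tensor _)) dev_fieldZD ipZD//; try exact: in_Lp_dev.
by do !move: (ip _ _) => ?; ring.
Qed.

Lemma advection_linear_l q : hdiv0 q -> linear_on hdiv0 (advection ^~ q).
Proof.
move=> /hdiv0_L2[? ?] a p r /hdiv0_L2[? ?] /hdiv0_L2[? ?]; rewrite /advection /=.
rewrite scalerDr scalerA [kappa^-1 * a]mulrC -scalerA field_tensorZD ipZD.
- by ring.
- exact: mOm.
- by apply: in_Lp_tensor => //; exact: in_LpZ.
- by apply: in_Lp_tensor => //; exact: in_LpZ.
- exact: in_Lp_dev.
Qed.

Lemma advection_le p q : hdiv0 p -> hdiv0 q ->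
  advection p q ^+ 2 <= B ^+ 2 * kappa^-1 ^+ 2 * nu^-1 * ip p.2 p.2 * energy q q.
Proof.
move=> /hdiv0_L2[Lp1 Lp2] /hdiv0_L2[Lq1 Lq2]; rewrite /advection exprMn.
have := tensor_dev_le (in_LpZ kappa^-1 Lp2) Lq1.
rewrite (ipZZ _ Lp2) => h; have n2 : 0 <= nu^-1 ^+ 2 by exact: sqr_ge0.
apply: (le_trans (ler_wpM2l n2 h)).
have := dev_le_energy Om nu_gt0 kappa_gt0 q => h2.
have c0 : 0 <= nu^-1 ^+ 2 * (B ^+ 2 * (kappa^-1 ^+ 2 * ip p.2 p.2)).
  by rewrite mulr_ge0// mulr_ge0 ?sqr_ge0// mulr_ge0 ?sqr_ge0 ?ip_ge0.
rewrite [leLHS]mulrA; apply: (le_trans (ler_wpM2l c0 h2)).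
rewrite le_eqVlt; apply/orP; left; apply/eqP; field.
by rewrite !gt_eqF.
Qed.

Lemma load_le : exists2 ML, 0 <= ML & forall q, hdiv0 q ->
  load q ^+ 2 <= ML * energy q q.
Proof.
set T := field_tensor (kappa^-1 *: f).
have LT : L2f T by apply: in_Lp_tensor => //; exact: in_LpZ.
exists (2 * (kappa^-1 ^+ 2 * ip f f * kappa + nu^-1 ^+ 2 * ip T T * nu)).
  by rewrite mulr_ge0// addr_ge0// mulr_ge0 ?(ltW nu_gt0) ?(ltW kappa_gt0)//
    mulr_ge0 ?sqr_ge0 ?ip_ge0.
move=> q Dq; have [Lq1 Lq2] := hdiv0_L2 Dq; rewrite /load -/T.
apply: (le_trans (sqrrD_le _ _)); rewrite sqrrN -[leRHS]mulrA ler_pM2l// [leRHS]mulrDl.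
apply: lerD; rewrite exprMn ?sqrrN -!mulrA;
  (do 2![apply: ler_wpM2l; first by rewrite invr_ge0 ltW]).
- rewrite ipC; apply: (le_trans (ip_CS mOm f_L2 Lq2)).
  apply: ler_wpM2l; first exact: ip_ge0.
  exact: div_le_energy.
- apply: (le_trans (ip_CS mOm LT (in_Lp_dev mOm Lq1))).
  apply: ler_wpM2l; first exact: ip_ge0.
  exact: dev_le_energy.
Qed.

(* The contraction estimate: the energy identity controls [dev e'.1], and then
   the inf-sup condition controls [e'.2] independently of kappa. *)
Lemma advection_contraction e e' : hdiv0 e -> hdiv0 e' ->
  (forall v, hdiv0 v -> energy e' v = - advection e v) ->
  ip e'.2 e'.2 <= ip e.2 e.2 / 4.
Proof.
move=> De De' E; have [Le1 Le2] := hdiv0_L2 De; have [Le'1 Le'2] := hdiv0_L2 De'.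
set u := kappa^-1 *: e.2; have Lu : L2f u by exact: in_LpZ.
set T := field_tensor u; have LT : L2f T by exact: in_Lp_tensor.
have Ldev : L2f (dev e'.1) by exact: in_Lp_dev.
have U0 := ip_ge0 Om u.
have x_le : ip (dev e'.1) (dev e'.1) <= B ^+ 2 * ip u u.
  apply: le_of_sqr; [exact: ip_ge0|by rewrite mulr_ge0 ?sqr_ge0|].
  apply: le_trans (tensor_dev_le Lu Le'1); rewrite -/T.
  (* Testing with e' itself and dropping the nonnegative divergence part of the energy. *)
  have h : ip (dev e'.1) (dev e'.1) <= - ip T (dev e'.1).
    have := E _ De'; rewrite /energy_form /advection -/u -/T => h.
    rewrite -(ler_pM2l (_ : 0 < nu^-1)) ?invr_gt0// mulrN -h lerDl.
    by rewrite mulr_ge0 ?ip_ge0 ?invr_ge0// ltW.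
  by rewrite -[leRHS]sqrrN lerXn2r ?nnegrE ?ip_ge0// (le_trans _ h) ?ip_ge0.
(* With this S the equation reads (div p, kappa^-1 div e') = - nu^-1 (S, p^d), the pairing bounded
   by the inf-sup condition; each summand has norm at most B |u|, whence the factor 2. *)
set S := 1 *: dev e'.1 + T.
have LS : L2f S by exact: in_LpZD.
have S_le : ip S S <= (2 * B) ^+ 2 * ip u u.
  have SE : ip S S = ip (dev e'.1) (dev e'.1) + 2 * ip (dev e'.1) T + ip T T.
    rewrite {1}/S ipZD// !(ipC _ _ S) /S !ipZD// (ipC _ T (dev _)); ring.
  have TT : ip T T <= B ^+ 2 * ip u u by exact: ip_tensor_le.
  have := ip_CS mOm Ldev LT => CS.
  have dT : ip (dev e'.1) T <= B ^+ 2 * ip u u.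
    have BU : 0 <= B ^+ 2 * ip u u by rewrite mulr_ge0 ?sqr_ge0.
    apply: (le_trans (ler_norm _)); rewrite -ler_sqr ?nnegrE// real_normK ?num_real//.
    by apply: (le_trans CS); rewrite expr2; apply: ler_pM => //; exact: ip_ge0.
  by rewrite SE exprMn; lra.
have key : gamma * Num.sqrt (ip (kappa^-1 *: e'.2) (kappa^-1 *: e'.2)) <=
    nu^-1 * (2 * B) * Num.sqrt (ip u u).
  apply: inf_sup_le => [||p Dp]; first exact: in_LpZ.
    by rewrite !mulr_ge0 ?invr_ge0 ?sqrtr_ge0// ltW.
  have [Lp1 Lp2] := hdiv0_L2 Dp.
  have Ldp : L2f (dev p.1) by exact: in_Lp_dev.
  have -> : ip p.2 (kappa^-1 *: e'.2) = nu^-1 * ip (- S) (dev p.1).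
    rewrite ipC ipZ// -scaleN1r ipZ// ipZD//.
    have := E _ Dp; rewrite /energy_form /advection -/u -/T.
    by do !move: (ip _ _) => ?; lra.
  rewrite -!mulrA; apply: ler_wpM2l; first by rewrite invr_ge0 ltW.
  have LNS : L2f (- S) by rewrite -scaleN1r; exact: in_LpZ.
  apply: (le_trans (sqrt_ip_CS LNS Ldp)).
  have -> : ip (- S) (- S) = ip S S.
    by rewrite -scaleN1r ipZZ// sqrrN expr1n mul1r.
  rewrite !mulrA; apply: ler_pM; rewrite ?sqrtr_ge0//.
    have B2 : 0 <= 2 * B by rewrite mulr_ge0.
    rewrite -[X in X * _](ger0_norm B2) -sqrtr_sqr -sqrtrM ?sqr_ge0//.
    by rewrite ler_wsqrtr.
  rewrite ler_wsqrtr//; apply: (le_trans (ip_dev_le mOm Lp1)).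
  by rewrite lerDl ip_ge0.
(* From 4 B <= nu gamma, the factor 2 B / (nu gamma) is at most 1/2. *)
have half : Num.sqrt (ip (kappa^-1 *: e'.2) (kappa^-1 *: e'.2)) <=
    Num.sqrt (ip u u) / 2.
  rewrite -(ler_pM2l gamma_gt0); apply: (le_trans key).
  rewrite (_ : gamma * (_ / 2) = gamma / 2 * Num.sqrt (ip u u)); last by ring.
  apply: ler_wpM2r; first exact: sqrtr_ge0.
  by rewrite ler_pdivrMl//; have := B_small; lra.
have : ip (kappa^-1 *: e'.2) (kappa^-1 *: e'.2) <= ip u u / 4.
  have := half; rewrite -ler_sqr ?nnegrE ?sqrtr_ge0 ?divr_ge0 ?sqrtr_ge0//.
  rewrite expr_div_n !sqr_sqrtr ?ip_ge0// (_ : 2 ^+ 2 = 4)//; ring.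
(* The common factor kappa^-2 cancels, which turns velocities back into divergences. *)
rewrite /u !ipZZ// -mulrA ler_pM2l//.
by rewrite exprn_gt0// invr_gt0.
Qed.

Lemma weak_solution_exists : exists2 p, hdiv0 p &
  forall q, hdiv0 q -> energy p q + advection p q = load q.
Proof.
have [ML ML0 MLP] := load_le.
apply: (@semi_picard _ _ hdiv0 energy (energy_inner oOm bOm nu_gt0 kappa_gt0)
  (energy_complete oOm bOm nu_gt0 kappa_gt0 C1_gt0 C1P)
  advection (fun p => ip p.2 p.2) load (B ^+ 2 * kappa^-1 ^+ 2 * nu^-1) ML kappa).
- by rewrite !mulr_ge0 ?sqr_ge0 ?invr_ge0// ltW.
- exact: ML0.
- exact: load_linear.
- exact: MLP.
- exact: advection_linear_r.
- exact: advection_linear_l.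
- by move=> p _; rewrite ip_ge0 div_le_energy.
- exact: advection_le.
- exact: advection_contraction.
Qed.

(** The difference satisfies the contraction estimate with itself as successor, so its divergence
    vanishes. Then the advection term and the energy vanish, and [C1] controls the field. *)
Lemma weak_solution_unique p p' : hdiv0 p -> hdiv0 p' ->
  (forall q, hdiv0 q -> energy p q + advection p q = load q) ->
  (forall q, hdiv0 q -> energy p' q + advection p' q = load q) ->
  ip (p'.1 - p.1) (p'.1 - p.1) = 0 /\ ip (p'.2 - p.2) (p'.2 - p.2) = 0.
Proof.
move=> Dp Dp' E E'.
have De : hdiv0 (p' - p) by rewrite addrC -scaleN1r; exact: hdiv0ZD.
have eE q : hdiv0 q -> energy (p' - p) q = - advection (p' - p) q.
  move=> Dq; have [_ _ _ lin _] := energy_inner oOm bOm nu_gt0 kappa_gt0.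
  rewrite addrC -scaleN1r lin// (advection_linear_l Dq)//.
  by have := E q Dq; have := E' q Dq; lra.
have N0 : ip (p'.2 - p.2) (p'.2 - p.2) = 0.
  have := advection_contraction De De eE; have := ip_ge0 Om (p' - p).2 => /= h1 h2; lra.
have e0 : energy (p' - p) (p' - p) = 0.
  have := advection_le De De; rewrite -sqrrN -eE// /= N0 mulr0 mul0r => h.
  by apply/eqP; rewrite -sqrf_eq0 eq_le h sqr_ge0.
split => //; apply/eqP; rewrite eq_le ip_ge0 andbT -(ler_pM2l C1_gt0) mulr0.
apply: (le_trans (hdiv0_C1 oOm bOm C1P De)); rewrite /= N0 addr0.
by have := dev_le_energy Om nu_gt0 kappa_gt0 (p' - p); rewrite e0 mulr0.
Qed.

Lemma ip_tensor_ae (v v' : field 1 2) (t : field 2 2) : L2f v -> L2f v' -> L2f t ->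
  {ae mu, forall x, Om x -> v x = v' x} ->
  ip (field_tensor v) t = ip (field_tensor v') t.
Proof.
move=> Lv Lv' Lt vv'; apply: ip_ae => //; [exact: in_Lp_tensor..|].
by apply: (@ae_imp _ (plane R)) vv' => x /= + Omx => ->.
Qed.

Lemma form_c_dev (v : field 1 2) (t : field 2 2) :
  form_c Om nu beta v t = nu^-1 * ip (field_tensor v) (dev t).
Proof.
rewrite /form_c; congr (_ * _); apply: eq_Rintegral => x _.
exact: frob_devl.
Qed.

Lemma form_dE (v u : field 1 2) : L2f v -> L2f u ->
  form_d Om kappa v u = kappa * ip u v.
Proof.
move=> Lv Lu; rewrite /form_d /integ RintegralZl//; last exact: frob_integrable.
by rewrite -/(integ _ _) -/(field_ip _ _ _) ipC.
Qed.

Lemma is_solutionP s z u : hdiv0 (s, z) -> L2f u ->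
  {ae mu, forall x, Om x -> u x = (kappa^-1 *: (z + f)) x} ->
  is_solution Om nu kappa beta f s u <->
  forall q, hdiv0 q -> energy (s, z) q + advection (s, z) q = load q.
Proof.
move=> Dsz Lu uE; have [/= Ls sz s0] := Dsz; have [Lz _] := sz.
have Lzf : L2f (z + f) by rewrite -[z]scale1r; exact: in_LpZD.
have Lu' : L2f (kappa^-1 *: (z + f)) by exact: in_LpZ.
have first t w : hdiv0 (t, w) ->
    form_a Om nu s t + form_b Om t u + form_c Om nu beta u t =
    energy (s, z) (t, w) + advection (s, z) (t, w) - load (t, w).
  move=> [/= Lt tw t0]; have [Lw _] := tw.
  have Ldt : L2f (dev t) by exact: in_Lp_dev.
  rewrite form_c_dev (ip_tensor_ae Lu Lu' Ldt uE).
  rewrite -[form_b _ _ _]/(ip (wdiv Om t) u) (ip_wdiv oOm bOm Lu tw).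
  rewrite ipC (ip_ae mOm Lu Lu' Lw uE).
  have LTz : L2f (field_tensor (kappa^-1 *: z)).
    by apply: in_Lp_tensor => //; exact: in_LpZ.
  have LTf : L2f (field_tensor (kappa^-1 *: f)).
    by apply: in_Lp_tensor => //; exact: in_LpZ.
  have -> : field_tensor (kappa^-1 *: (z + f)) =
      1 *: field_tensor (kappa^-1 *: z) + field_tensor (kappa^-1 *: f).
    by rewrite -field_tensorZD scale1r scalerDr.
  rewrite (ipZD mOm 1 LTz LTf Ldt) (ipZ _ Lzf Lw) -[z in z + f]scale1r.
  rewrite (ipZD mOm 1 Lz f_L2 Lw) /form_a -[integ _ _]/(ip (dev s) (dev t)).
  rewrite /energy_form /advection /load /= (ipC _ w f).
  by do !move: (ip _ _) => ?; ring.
(* The second equation holds for every v by the choice of u. *)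
have second v : L2f v ->
    form_b Om s v - form_d Om kappa v u = - integ Om (fun x => frob (f x) (v x)).
  move=> Lv; rewrite form_dE// (ip_ae mOm Lu Lu' Lv uE) ipZ// mulVKf ?gt_eqF//.
  rewrite -[form_b _ _ _]/(ip (wdiv Om s) v) (ip_wdiv oOm bOm Lv sz).
  rewrite -[z in z + f]scale1r (ipZD mOm 1 Lz f_L2 Lv) -[integ _ _]/(ip f v).
  by ring.
split=> [[_ _ eq1 _] [t w] Dtw|E].
  apply/eqP; rewrite -subr_eq0 -first//; apply/eqP/eq1.
  by apply/in_Hdiv0P => //; exists w.
split => //.
- by apply/in_Hdiv0P => //; exists z.
- by move=> t /hdiv0_wdiv Dt; rewrite (first _ _ Dt) E// subrr.
Qed.

(** The second equation is tested with its own residual div s + f - kappa u, whose norm is therefore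
    zero. *)
Lemma solution_velocity s u : is_solution Om nu kappa beta f s u ->
  {ae mu, forall x, Om x -> u x = (kappa^-1 *: (wdiv Om s + f)) x}.
Proof.
move=> [Hs Lu _ eq2]; set z := wdiv Om s.
have [/= Ls [Lz _] _] := hdiv0_wdiv Hs; rewrite -/z in Lz.
have Lzf : L2f (z + f) by rewrite -[z]scale1r; exact: in_LpZD.
pose g : field 1 2 := (z + f) - kappa *: u.
have Lku : L2f (kappa *: u) by exact: in_LpZ.
have Lg : L2f g by exact: in_LpB.
have : ip g g = 0.
  rewrite {1}/g (ipB oOm)// -[z in z + f]scale1r (ipZD mOm 1 Lz f_L2 Lg) ipZ//.
  have := eq2 g Lg; rewrite form_dE// -[form_b _ _ _]/(ip z g) -[integ _ _]/(ip f g).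
  by lra.
move=> /(ip_eq0_ae mOm Lg); apply: (@ae_imp _ (plane R)) => x gx Omx.
have /eqP := gx Omx; rewrite subr_eq0 => /eqP E.
by rewrite -[RHS]/(kappa^-1 *: (z + f) x) E scalerA mulVf ?gt_eqF// scale1r.
Qed.

Lemma well_posed : exists (s : field 2 2) (u : field 1 2),
  is_solution Om nu kappa beta f s u /\
  forall s' u', is_solution Om nu kappa beta f s' u' ->
    {ae mu, forall x, Om x -> s' x = s x} /\ {ae mu, forall x, Om x -> u' x = u x}.
Proof.
have [[s z] Dsz E] := weak_solution_exists.
have [/= Ls [Lz _] _] := Dsz.
pose u : field 1 2 := kappa^-1 *: (z + f).
have Lu : L2f u by apply: in_LpZ; rewrite -[z]scale1r; exact: in_LpZD.
exists s, u; split.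
  apply/(is_solutionP Dsz Lu) => //.
  by apply: (@aeW _ (plane R)).
move=> s' u' sol'; have uE' := solution_velocity sol'.
have [Hs' Lu' _ _] := sol'; have Dsz' := hdiv0_wdiv Hs'.
have [/= Ls' [Lz' _] _] := Dsz'.
have E' := (is_solutionP Dsz' Lu' uE').1 sol'.
have [ds dz] := weak_solution_unique Dsz Dsz' E E'.
have {}ds := ip_eq0_ae mOm (in_LpB oOm Ls' Ls) ds.
have {}dz := ip_eq0_ae mOm (in_LpB oOm Lz' Lz) dz.
split.
  apply: (@ae_imp _ (plane R)) ds => x /= sx Omx.
  by apply/eqP; rewrite -subr_eq0; apply/eqP/sx.
apply: (@ae_imp2 _ (plane R)) uE' dz => x /= ux zx Omx; rewrite ux//.
have /eqP := zx Omx; rewrite subr_eq0 => /eqP E2.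
by rewrite /u -[LHS]/(kappa^-1 *: (wdiv Om s' x + f x)) E2.
Qed.

End WellPosedness.

Theorem theorem2p3 (R : realType) (Om : set (R * R)) (nu kappa : R)
    (beta f : R * R -> 'rV[R]_2) (C1 gamma : R)
    (dom_Om : bounded_domain Om) (lip_Om : lipschitz_boundary Om)
    (nu_gt0 : 0 < nu) (kappa_gt0 : 0 < kappa)
    (beta_W1oo : in_W1oo Om beta) (f_L2 : in_Lp Om 2%:E f)
    (C1_gt0 : 0 < C1) (C1P : deviator_bound Om C1)
    (gamma_gt0 : 0 < gamma) (gammaP : inf_sup_b Om gamma) :
  let beta_oo := Lp_norm Om +oo%E beta in
  let k := (2 + Num.sqrt 2) ^+ 2 in
  let Chat := k / (4 * nu * Num.sqrt C1 * gamma) in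
  let H := Chat * beta_oo ^+ 2
           + k / (kappa * (k / 4) + 2 * nu * gamma ^+ 2) * Lp_norm Om 2%:E f in
  0 < 1 - 4 * Chat * H ->
  beta_oo * (2 + Num.sqrt 2) / (2 * nu)
    * (1 + k / (2 * nu)
           * (Num.min nu^-1 kappa * Num.min C1 1)^-1) < gamma ->
  exists (sigma : R * R -> 'M[R]_2) (u : R * R -> 'rV[R]_2),
    is_solution Om nu kappa beta f sigma u /\
    forall (sigma' : R * R -> 'M[R]_2) (u' : R * R -> 'rV[R]_2),
      is_solution Om nu kappa beta f sigma' u' ->
      (sigma' = sigma %[ae lebesgue2 R in Om]) /\
      (u' = u %[ae lebesgue2 R in Om]).
Proof.
move=> B k Chat H _ small.
have [_ oOm _ bOm] := dom_Om; have [boo _] := beta_W1oo.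
apply: (well_posed oOm bOm nu_gt0 kappa_gt0 C1_gt0 gamma_gt0 boo f_L2 C1P gammaP).
have [B0 _] := Loo_enorm_le boo; rewrite -/B in B0 *.
set m := Num.min nu^-1 kappa * Num.min C1 1 in small.
have m0 : 0 < m by rewrite mulr_gt0// lt_min ?invr_gt0 ?nu_gt0 ?C1_gt0 ?ltr01.
have m_le : m <= nu^-1.
  rewrite -[leRHS]mulr1; apply: ler_pM; rewrite ?le_min ?ge_min ?lexx ?orbT ?invr_ge0//.
  - by rewrite !ltW.
  - by rewrite ler01 ltW.
have nu_le : nu <= m^-1 by rewrite -[nu]invrK lef_pV2 ?posrE ?invr_gt0.
(* Crude bounds suffice: sqrt 2 >= 1 gives k >= 9, and nu <= 1/m gives k / (2 nu m) >= 9/2, so the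
   bracket is at least 4. *)
have s3 : 3 <= 2 + Num.sqrt 2 :> R.
  have : 1 <= Num.sqrt 2 :> R by rewrite -[leLHS]sqrtr1 ler_wsqrtr// ler1n.
  lra.
have k9 : 9 <= k.
  rewrite /k (_ : 9 = 3 ^+ 2); last by ring.
  by rewrite lerXn2r ?nnegrE// (le_trans _ s3).
have big : 4 <= 1 + k / (2 * nu) * m^-1.
  have : 9 / 2 <= k / (2 * nu) * m^-1.
    have -> : 9 / 2 = 9 / (2 * nu) * nu by field; rewrite gt_eqF.
    apply: ler_pM => //; first by rewrite divr_ge0// mulr_ge0// ltW.
    - exact: ltW.
    - by rewrite ler_pM2r// invr_gt0 mulr_gt0.
  lra.
(* Since (2 + sqrt 2) / 2 >= 1, the left factor is at least B / nu; with the bracket this gives 4 B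
   / nu <= gamma. *)
have Bs : B / nu <= B * (2 + Num.sqrt 2) / (2 * nu).
  rewrite -mulrA; apply: ler_wpM2l => //.
  by rewrite ler_pdivlMr ?mulr_gt0// mulrCA mulVf ?gt_eqF//; lra.
have : B / nu * 4 <= gamma.
  apply: le_trans (ltW small); apply: ler_pM => //.
  by rewrite divr_ge0// ltW.
by rewrite mulrAC ler_pdivrMr// mulrC [gamma * _]mulrC.
Qed.
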